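(* Let $u\in L^\infty([0,1]\times\mathbb T^2)$ be a vector field with $\nabla\cdot u=0$ and let $\theta_0\in L^2(\mathbb T^2)$. For all $\kappa>0$, let $\theta^\kappa$ solve $$\partial_t\theta^\kappa-\kappa\Delta\theta^\kappa+u\cdot\nabla\theta^\kappa=0\ \text{ in }(0,1)\times\mathbb T^2,\qquad\theta^\kappa(0,\cdot)=\theta_0.$$ Suppose that for some $\theta\in L^\infty([0,1],L^2(\mathbb T^2))$ and some sequence of positive numbers $\kappa_j\to0$, $\theta^{\kappa_j}\rightharpoonup\theta$ weakly-$*$ in $L^\infty([0,1],L^2(\mathbb T^2))$. Suppose also that $E(t):=\|\theta(t,\cdot)\|_{L^2(\mathbb T^2)}^2$ is not continuous (i.e. does not coincide for a.e. $t\in[0,1]$ with a continuous function). Then, for any $s>0$, $$\lim_{j\to\infty}\|\theta^{\kappa_j}\|_{L^\infty([0,1],H^s(\mathbb T^2))}=\infty.$$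
   Context: $\mathbb T^2$ is $[0,\sqrt2]\times[0,1]$ with periodic boundary. $\|f\|_{H^s(\mathbb T^2)}:=\|(-\Delta)^{s/2}f\|_{L^2(\mathbb T^2)}$, with $(-\Delta)^{s/2}$ defined via Fourier series (it annihilates constants; value $+\infty$ if not in $L^2$). *)

(* Defs.v *)
From HB Require Import structures.
From mathcomp Require Import all_boot all_order all_algebra.
From mathcomp Require Import all_classical all_reals all_analysis.
From mathcomp Require Import complex.

Set Implicit Arguments.
Unset Strict Implicit.
Unset Printing Implicit Defensive.

Import Order.TTheory GRing.Theory Num.Theory.
Import numFieldTopology.Exports numFieldNormedType.Exports.

Local Open Scope classical_set_scope.
Local Open Scope ring_scope.

(* The library's own finite-measure instance on m1 \x m2 is only inferred for
   subprobabilities. *)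
Lemma fin_num_fun_product_measure1 (d1 d2 : measure_display)
    (T1 : measurableType d1) (T2 : measurableType d2) (R : realType)
    (m1 : {finite_measure set T1 -> \bar R})
    (m2 : {finite_measure set T2 -> \bar R}) :
  fin_num_fun (m1 \x m2)%E.
Proof.
move=> A mA; rewrite ge0_fin_numE ?measure_ge0//.
apply: (@le_lt_trans _ _ ((m1 \x m2)%E [set: T1 * T2])).
  by apply: le_measure; rewrite ?inE.
rewrite -setXTT product_measure1E// lte_mul_pinfty//.
  exact: fin_num_measure.
by rewrite -ge0_fin_numE// fin_num_measure.
Qed.

(* The torus is [0, sqrt 2] x [0, 1] with periodic boundary. A function on it is
   a function on the plane of which only the values on this fundamental domain
   matter: all norms and integrals are with respect to Lebesgue measure
   restricted to the domain, and periodicity is required of test functions.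
   The types below are R * R and R * (R * R), seen as products of measurable types; a point
   of space-time is written (t, (x1, x2)). *)
Notation plane R := (measurableTypeR R * measurableTypeR R)%type.
Notation spacetime R := (measurableTypeR R * plane R)%type.

Section measures.
Variable R : realType.

Lemma lebesgue_itv0_lty (L : R) :
  (@lebesgue_measure R `[0%R, L]%classic < +oo)%E.
Proof. by rewrite lebesgue_measure_itv /=; case: ifPn => // _; rewrite ltry. Qed.

Definition lebesgue0 (L : R) :
    {finite_measure set (measurableTypeR R) -> \bar R} :=
  @mfrestr _ (measurableTypeR R) R _ lebesgue_measure
    (measurable_itv `[0, L]) (lebesgue_itv0_lty L).

Definition time_measure : {finite_measure set (measurableTypeR R) -> \bar R} :=
  lebesgue0 1.

Definition torus_measure : set (plane R) -> \bar R :=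
  (lebesgue0 (Num.sqrt 2) \x lebesgue0 1)%E.

HB.instance Definition _ := Measure.on torus_measure.

Lemma torus_measure_fin : fin_num_fun torus_measure.
Proof. exact: fin_num_fun_product_measure1. Qed.

HB.instance Definition _ :=
  Measure_isFinite.Build _ _ _ torus_measure torus_measure_fin.

Definition spacetime_measure : set (spacetime R) -> \bar R :=
  (time_measure \x torus_measure)%E.

HB.instance Definition _ := Measure.on spacetime_measure.

Lemma spacetime_measure_fin : fin_num_fun spacetime_measure.
Proof. exact: fin_num_fun_product_measure1. Qed.

HB.instance Definition _ :=
  Measure_isFinite.Build _ _ _ spacetime_measure spacetime_measure_fin.

End measures.

Section torus.
Variable R : realType.
Implicit Types (f g : R * R -> R) (h phi : R * (R * R) -> R).
Local Notation mu_t := (@time_measure R).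
Local Notation mu_x := (@torus_measure R).
Local Notation mu_tx := (@spacetime_measure R).

Definition L2norm f : \bar R := ('N[mu_x]_(2%:E) [EFin \o f])%E.

Definition L2 f : Prop := f \in Lfun mu_x 2%:E.

Definition wavevector (k : int * int) : R * R :=
  (2 * pi * k.1%:~R / Num.sqrt 2, 2 * pi * k.2%:~R).

Definition phase (k : int * int) (x : R * R) : R :=
  (wavevector k).1 * x.1 + (wavevector k).2 * x.2.

Definition wavenumber (k : int * int) : R :=
  Num.sqrt ((wavevector k).1 ^+ 2 + (wavevector k).2 ^+ 2).

(* |T^2|^-1 \int_(T^2) f(x) e^(- i xi_k . x) dx, where |T^2| = sqrt 2. *)
Definition fourier f (k : int * int) : R[i] :=
  ((Num.sqrt 2)^-1 * \int[mu_x]_x (f x * cos (phase k x)) -i*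
   ((Num.sqrt 2)^-1 * \int[mu_x]_x (f x * sin (phase k x))))%C.

(* g = (- Delta)^(s/2) f, as an element of L^2; for s > 0 the mode k = 0 is
   annihilated because 0 `^ s = 0. *)
Definition frac_laplacian (s : R) f g : Prop :=
  L2 g /\
  forall k, fourier g k = (wavenumber k `^ s)%:C%C * fourier f k.

(* g is unique up to null sets when it exists; otherwise the infimum is +oo. *)
Definition Hs_norm (s : R) f : \bar R :=
  ereal_inf [set L2norm g | g in frac_laplacian s f].

Definition slice h (t : R) : R * R -> R := fun x => h (t, x).

Definition LinfL2_norm h : \bar R :=
  ('N[mu_t]_(+oo) [(fun t : R => L2norm (slice h t))])%E.

Definition L1L2_norm h : \bar R :=
  ('N[mu_t]_(1%:E) [(fun t : R => L2norm (slice h t))])%E.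

Definition LinfHs_norm (s : R) h : \bar R :=
  ('N[mu_t]_(+oo) [(fun t : R => Hs_norm s (slice h t))])%E.

Definition LinfL2 h : Prop :=
  measurable_fun [set: spacetime R] h /\ (LinfL2_norm h < +oo)%E.

Definition L1L2 h : Prop :=
  measurable_fun [set: spacetime R] h /\ (L1L2_norm h < +oo)%E.

Definition Linf_field (u : R * (R * R) -> R * R) : Prop :=
  (fun z => (u z).1) \in Lfun mu_tx +oo%E /\
  (fun z => (u z).2) \in Lfun mu_tx +oo%E.

(* L^oo([0,1], L^2) is the dual of L^1([0,1], L^2). *)
Definition weak_star_cvg (hn : nat -> R * (R * R) -> R) h : Prop :=
  forall g : R * (R * R) -> R, L1L2 g ->
    (\int[mu_tx]_z (hn n z * g z)) @[n --> \oo] -->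
      \int[mu_tx]_z (h z * g z).

Definition dt phi : R * (R * R) -> R := 'D_(1, (0, 0)) phi.
Definition dx1 phi : R * (R * R) -> R := 'D_(0, (1, 0)) phi.
Definition dx2 phi : R * (R * R) -> R := 'D_(0, (0, 1)) phi.
Definition laplacian phi : R * (R * R) -> R :=
  fun z => dx1 (dx1 phi) z + dx2 (dx2 phi) z.

Fixpoint Ck (n : nat) phi : Prop :=
  continuous phi /\
  if n is m.+1 then
    (forall z v, derivable phi z v) /\ (forall v, Ck m ('D_v phi))
  else True.

Definition periodic phi : Prop := forall t x1 x2,
  phi (t, (x1 + Num.sqrt 2, x2)) = phi (t, (x1, x2)) /\
  phi (t, (x1, x2 + 1)) = phi (t, (x1, x2)).

Definition smooth phi : Prop := periodic phi /\ forall n, Ck n phi.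

(* The restrictions of these functions to t >= 0 form C_c^oo([0,1) x T^2). *)
Definition test_initial phi : Prop :=
  smooth phi /\
  exists2 b : R, b < 1 & forall t x, b <= t -> phi (t, x) = 0.

(* The class C_c^oo((0,1) x T^2). *)
Definition test_interior phi : Prop :=
  test_initial phi /\
  exists2 a : R, 0 < a & forall t x, t <= a -> phi (t, x) = 0.

Definition dot_grad (u : R * (R * R) -> R * R) phi : R * (R * R) -> R :=
  fun z => (u z).1 * dx1 phi z + (u z).2 * dx2 phi z.

(* In the sense of distributions on (0,1) x T^2. *)
Definition divergence_free (u : R * (R * R) -> R * R) : Prop :=
  forall phi, test_interior phi ->
    \int[mu_tx]_z dot_grad u phi z = 0.

(* Weak solutions, in L^oo([0,1], L^2), of
     d_t h - kappa Delta h + u . grad h = 0,  h(0, .) = h0.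
   As div u = 0, u . grad h is div (h u). *)
Definition solves (u : R * (R * R) -> R * R) (kappa : R)
    (h0 : R * R -> R) h : Prop :=
  LinfL2 h /\
  forall phi, test_initial phi ->
    \int[mu_tx]_z (h z * (dt phi z + kappa * laplacian phi z
                              + dot_grad u phi z))
    + \int[mu_x]_x (h0 x * phi (0, x)) = 0.

Definition energy h (t : R) : \bar R := (L2norm (slice h t) `^ 2)%E.

Definition ae_eq_continuous (E : R -> \bar R) : Prop :=
  exists c : R -> R, {within `[0, 1], continuous c} /\
    \forall t \ae mu_t, E t = (c t)%:E.

End torus.

(* Main.v *)
Require Import Defs.
From mathcomp Require Import all_boot all_order all_algebra.
From mathcomp Require Import all_classical all_reals all_analysis.
From mathcomp Require Import measurable_realfun ess_sup_inf complex zify ring lra.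

(* Suppose that the L^oo H^s norms do not tend to infinity; then they are bounded
   along arbitrarily large j. Passing to the limit in the weak formulation with the
   test functions chi(t) cos(xi_k . x) and chi(t) sin(xi_k . x) shows that theta solves
   the transport equation, so that each Fourier coefficient of theta(t, .) has an
   integrable time derivative and agrees for a.e. t with a continuous function.
   By weak-* lower semicontinuity theta inherits the L^oo H^s bound, which controls
   the high-frequency part of the energy uniformly in t. By Parseval, E is then for
   a.e. t a uniform limit of continuous functions, a contradiction.
   For Parseval, the sets whose indicator is an L^2 limit of trigonometric polynomials
   form a sigma-algebra containing the rays x_i > a, hence all measurable sets. *)

Set Implicit Arguments.
Unset Strict Implicit.
Unset Printing Implicit Defensive.

Import Order.TTheory GRing.Theory Num.Theory.
Import numFieldTopology.Exports numFieldNormedType.Exports.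

Local Open Scope classical_set_scope.
Local Open Scope ring_scope.

(** The test functions must be smooth to every order and vanish near t = 1. So chi is taken from an
    explicit family that is closed under differentiation: a polynomial in 1/y times y exp(-c/y),
    evaluated at y = b - t. As c tends to 0 the basic member tends to the positive part of b - t,
    and the resulting identities for all b in [0, 1[ determine each Fourier coefficient of theta for
    a.e. t. The H^s bound is never handled as a function of time. It is transferred through
    [weighted_energy], a finite sum over a box of modes, which is measurable in t; boxes of every
    size are treated separately and combined only at the end. For one box, lower semicontinuity is
    obtained by testing against a function built from theta itself, cut off to the set of times at
    which the bound fails. The rays in the density argument are superlevel sets, at height 1/2, of
    trigonometric polynomials with values in [0, 1]; polynomials steepening at 1/2 then produce
    their indicators. *)

Local Notation rintegrable mu f := (mu.-integrable [set: _] (EFin \o f)).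

(** * Real integrals and square-integrable functions for a finite measure *)

Section square_integrable.
Context d (T : measurableType d) (R : realType).
Variable mu : {finite_measure set T -> \bar R}.
Implicit Types f g h : T -> R.

Lemma ae_imply (P Q : T -> Prop) : (forall x, P x -> Q x) ->
  (\forall x \ae mu, P x) -> \forall x \ae mu, Q x.
Proof. by move=> PQ; apply: filterS. Qed.

Lemma ae_and (P Q : T -> Prop) : (\forall x \ae mu, P x) ->
  (\forall x \ae mu, Q x) -> \forall x \ae mu, P x /\ Q x.
Proof. exact: filterI. Qed.

Lemma rintegrableP f :
  rintegrable mu f -> measurable_fun setT f.
Proof. by move=> /measurable_int /measurable_EFinP. Qed.

Lemma rintegrable_le f g : measurable_fun setT f -> rintegrable mu g ->
  (forall x, `|f x| <= g x) -> rintegrable mu f.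
Proof.
move=> mf ig fg; apply: le_integrable ig => //=; first exact/measurable_EFinP.
by move=> x _; rewrite lee_fin (le_trans (fg x))// ler_norm.
Qed.

Lemma rintegrable_ae_le f g : measurable_fun setT f -> rintegrable mu g ->
  (\forall x \ae mu, `|f x| <= g x) -> rintegrable mu f.
Proof.
move=> mf ig fg; apply/integrableP; split; first exact/measurable_EFinP.
have /integrableP[mg] := ig; apply: le_lt_trans; apply: ae_ge0_le_integral => //.
- by apply: measurableT_comp => //; exact/measurable_EFinP.
- exact: measurableT_comp.
- by apply: ae_imply fg => x fx _; rewrite lee_fin (le_trans fx)// ler_norm.
Qed.

Lemma rintegrableD f g : rintegrable mu f -> rintegrable mu g ->
  rintegrable mu (fun x => f x + g x).
Proof. exact: integrableD. Qed.

Lemma rintegrableZ c f : rintegrable mu f -> rintegrable mu (fun x => c * f x).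
Proof. exact: integrableZl. Qed.

Lemma rintegrableB f g : rintegrable mu f -> rintegrable mu g ->
  rintegrable mu (fun x => f x - g x).
Proof. exact: integrableB. Qed.

Lemma rintegrable_cst c : rintegrable mu (fun=> c).
Proof. exact: finite_measure_integrable_cst. Qed.

Lemma rintegrable_bounded f M : measurable_fun setT f ->
  (forall x, `|f x| <= M) -> rintegrable mu f.
Proof. by move=> mf fM; apply: rintegrable_le (rintegrable_cst M) fM. Qed.

Lemma rintegrable_sum I (r : seq I) (P : pred I) (F : I -> T -> R) :
  (forall i, P i -> rintegrable mu (F i)) ->
  rintegrable mu (fun x => \sum_(i <- r | P i) F i x).
Proof.
move=> iF; have := @integrable_sum _ T R mu setT measurableT I r P
  (fun i x => (F i x)%:E) iF.
by apply: eq_integrable => // x _ /=; rewrite sumEFin.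
Qed.

Lemma Rintegral_sum I (r : seq I) (P : pred I) (F : I -> T -> R) :
  (forall i, P i -> rintegrable mu (F i)) ->
  \int[mu]_x (\sum_(i <- r | P i) F i x) = \sum_(i <- r | P i) \int[mu]_x F i x.
Proof.
move=> iF; elim: r => [|i r IH].
  by under eq_Rintegral do rewrite big_nil; rewrite big_nil Rintegral_cst// mul0r.
rewrite big_cons -IH; case: ifPn => Pi; last first.
  by apply: eq_Rintegral => x _; rewrite big_cons (negbTE Pi).
rewrite -RintegralD//; [|exact: iF|exact: rintegrable_sum].
by apply: eq_Rintegral => x _; rewrite big_cons Pi.
Qed.

(** A single notion for the torus and for space-time, under which products are integrable as real
    functions. *)
Definition sqint f :=
  measurable_fun setT f /\ rintegrable mu (fun x => f x ^+ 2).

Lemma sqint_mul f g : sqint f -> sqint g -> rintegrable mu (fun x => f x * g x).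
Proof.
move=> [mf if2] [mg ig2].
apply: (@rintegrable_le _ (fun x => f x ^+ 2 + g x ^+ 2)).
- exact: measurable_funM.
- exact: rintegrableD.
- move=> x; rewrite ler_norml; nra.
Qed.

Lemma sqint_bounded f M : measurable_fun setT f ->
  (forall x, `|f x| <= M) -> sqint f.
Proof.
move=> mf fM; split => //; apply: (@rintegrable_bounded _ (M ^+ 2)).
  exact: measurable_funX.
by move=> x; rewrite normrX lerXn2r// ?nnegrE// (le_trans _ (fM x)).
Qed.

Lemma sqint_ae_bounded f M : measurable_fun setT f ->
  (\forall x \ae mu, `|f x| <= M) -> sqint f.
Proof.
move=> mf fM; split => //; apply: (rintegrable_ae_le _ (rintegrable_cst (M ^+ 2))).
  exact: measurable_funX.
by apply: ae_imply fM => x fx; rewrite normrX lerXn2r// ?nnegrE// (le_trans _ fx).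
Qed.

Lemma sqint_cst c : sqint (fun=> c).
Proof. by apply: (@sqint_bounded _ `|c|). Qed.

Lemma sqint_rintegrable f : sqint f -> rintegrable mu f.
Proof.
move=> /sqint_mul/(_ (sqint_cst 1)).
by apply: eq_integrable => // x _ /=; rewrite mulr1.
Qed.

Lemma sqintZ c f : sqint f -> sqint (fun x => c * f x).
Proof.
move=> [mf if2]; split; first exact: measurable_funM.
have := rintegrableZ (c ^+ 2) if2.
by apply: eq_integrable => // x _ /=; rewrite exprMn.
Qed.

Lemma sqintD f g : sqint f -> sqint g -> sqint (fun x => f x + g x).
Proof.
move=> sf sg; split; first by apply: measurable_funD; [case: sf|case: sg].
have := rintegrableD (rintegrableD sf.2 (rintegrableZ 2 (sqint_mul sf sg))) sg.2.
by apply: eq_integrable => // x _ /=; congr EFin; ring.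
Qed.

Lemma sqintB f g : sqint f -> sqint g -> sqint (fun x => f x - g x).
Proof.
move=> sf /(sqintZ (-1)) /(sqintD sf).
by congr sqint; apply/funext => x; rewrite mulN1r.
Qed.

Lemma sqintM_bounded f g M : measurable_fun setT f ->
  (forall x, `|f x| <= M) -> sqint g -> sqint (fun x => f x * g x).
Proof.
move=> mf fM [mg ig]; split; first exact: measurable_funM.
apply: (@rintegrable_le _ (fun x => M ^+ 2 * g x ^+ 2)).
- by apply: measurable_funX; exact: measurable_funM.
- exact: rintegrableZ.
- move=> x; rewrite ger0_norm ?sqr_ge0// exprMn ler_wpM2r ?sqr_ge0//.
  by rewrite -(real_normK (num_real (f x))) lerXn2r// ?nnegrE// (le_trans _ (fM x)).
Qed.

Lemma sqint_sum I (r : seq I) (P : pred I) (F : I -> T -> R) :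
  (forall i, P i -> sqint (F i)) -> sqint (fun x => \sum_(i <- r | P i) F i x).
Proof.
move=> sF; elim: r => [|i r IH].
  by under eq_fun do rewrite big_nil; exact: sqint_cst.
case/boolP: (P i) => Pi; last first.
  by under eq_fun do rewrite big_cons (negbTE Pi).
by under eq_fun do rewrite big_cons Pi; apply: sqintD => //; exact: sF.
Qed.

Lemma ae_eq_Rintegral f g : measurable_fun setT f -> measurable_fun setT g ->
  (\forall x \ae mu, f x = g x) -> \int[mu]_x f x = \int[mu]_x g x.
Proof.
move=> mf mg fg; congr fine; apply: ae_eq_integral => //.
- exact/measurable_EFinP.
- exact/measurable_EFinP.
- by apply: filterS fg => x /= ->.
Qed.

Lemma Rintegral_dominated (f_ : nat -> T -> R) f g :
  (forall n, measurable_fun setT (f_ n)) -> measurable_fun setT f ->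
  (\forall x \ae mu, f_ n x @[n --> \oo] --> f x) ->
  rintegrable mu g -> (\forall x \ae mu, forall n, `|f_ n x| <= g x) ->
  \int[mu]_x f_ n x @[n --> \oo] --> \int[mu]_x f x.
Proof.
move=> mf_ mf fcvg ig fg.
have [] := @dominated_convergence _ T R mu setT measurableT
  (fun n x => (f_ n x)%:E) (EFin \o f) (EFin \o g).
- by move=> n; exact/measurable_EFinP.
- exact/measurable_EFinP.
- by apply: filterS fcvg => x fx _ /=; apply: cvg_EFin => //; near=> n.
- exact: ig.
- by apply: filterS fg => x fx n _ /=; rewrite lee_fin.
- move=> iF _ F; apply: fine_cvg; rewrite /Rintegral fineK//.
  exact: integrable_fin_num.
Unshelve. all: by end_near. Qed.

End square_integrable.

(** * Lebesgue measure restricted to [0, L] *)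

Section restricted_lebesgue.
Variable R : realType.
Implicit Types (f : R -> R) (L : R).

Lemma lebesgue0T L : 0 <= L -> lebesgue0 L setT = L%:E.
Proof.
move=> L0; rewrite /lebesgue0 /= /mfrestr /mrestr setTI lebesgue_measure_itv /=.
rewrite lte_fin; case: ltP => [_|]; first by rewrite sube0.
by move=> L0'; congr EFin; apply/eqP; rewrite eq_le L0 L0'.
Qed.

Lemma lebesgue0_ae L (P : R -> Prop) :
  (\forall x \ae (@lebesgue_measure R), x \in `[0, L] -> P x) ->
  \forall x \ae (lebesgue0 L), P x.
Proof.
(* The restricted measure does not charge the complement of [0, L], which is added to the null
   set. *)
move=> [N [mN N0 PN]]; exists (N `|` ~` `[0, L]%classic); split.
- by apply: measurableU => //; exact: measurableC.
- rewrite /lebesgue0 /= /mfrestr /mrestr setIUl setICl setU0.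
  by apply/eqP; rewrite eq_le measure_ge0 andbT -N0 measureIl.
- move=> x /= nPx; have [xL|] := pselect (`[0, L]%classic x); last by right.
  by left; apply: PN => /= /(_ xL).
Qed.

Lemma ae_lebesgue0 L (P : R -> Prop) :
  (\forall x \ae (lebesgue0 L), P x) ->
  \forall x \ae (@lebesgue_measure R), x \in `[0, L] -> P x.
Proof.
move=> [N [mN N0 PN]]; exists (N `&` `[0, L]%classic); split => //.
- exact: measurableI.
- by move=> x /= /not_implyP[xL nPx]; split => //; exact: PN.
Qed.

Lemma integral_lebesgue0 L f : measurable_fun setT f ->
  (\int[lebesgue0 L]_x (f x)%:E = \int[lebesgue_measure]_(x in `[0%R, L]) (f x)%:E)%E.
Proof.
move=> mf; transitivity (\int[lebesgue0 L]_(x in `[0%R, L]) (f x)%:E)%E; last first.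
  apply: eq_measure_integral => A mA AL.
  by rewrite /lebesgue0 /= /mfrestr /mrestr setIidl.
rewrite [RHS]integral_mkcond; apply: ae_eq_integral => //.
- exact/measurable_EFinP.
- apply/(measurable_restrictT _ _).1 => //.
  by apply/measurable_funTS/measurable_EFinP.
- apply: lebesgue0_ae; apply: aeW => x xL _.
  by rewrite patchE mem_set.
Qed.

Lemma Rintegral_lebesgue0 L f : measurable_fun setT f ->
  \int[lebesgue0 L]_x f x = \int[lebesgue_measure]_(x in `[0, L]) f x.
Proof. by move=> mf; rewrite /Rintegral integral_lebesgue0. Qed.

Lemma rintegrable_lebesgue0 L f : measurable_fun setT f ->
  rintegrable (lebesgue0 L) f <->
  lebesgue_measure.-integrable `[0, L] (EFin \o f).
Proof.
move=> mf; have mn : measurable_fun setT (fun x => `|f x|) by exact: measurableT_comp.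
split => /integrableP[_ h]; apply/integrableP; split.
- exact/measurable_EFinP/measurable_funTS.
- by rewrite -integral_lebesgue0.
- exact/measurable_EFinP.
- by rewrite (integral_lebesgue0 _ mn).
Qed.

Lemma Rintegral_lebesgue0_derive L f (F : R -> R) : 0 < L -> continuous f ->
  (forall x : R, is_derive x (1 : R) F (f x)) ->
  \int[lebesgue0 L]_x f x = F L - F 0.
Proof.
move=> L0 cf dF; rewrite Rintegral_lebesgue0; last first.
  exact: continuous_measurable_fun.
have cF : continuous F.
  by move=> x; apply: differentiable_continuous; exact/derivable1_diffP.
rewrite /Rintegral (@continuous_FTC2 _ f F)//.
- exact: continuous_subspaceT.
- split.
  + by move=> x _; exact: ex_derive.
  + exact/cvg_at_right_filter/cF.
  + exact/cvg_at_left_filter/cF.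
- by move=> x _; rewrite derive1E derive_val.
Qed.

End restricted_lebesgue.

(** In Fubini's theorem the inner integral may be infinite on a null set, where [fine] makes it 0;
    this bound keeps the outer integrability. *)
Lemma le_abse_fine (R : realType) (z : \bar R) : (`|(fine z)%:E| <= `|z|)%E.
Proof. by case: z => //=; rewrite normr0 leey. Qed.

(** * Fubini's theorem for real-valued integrals *)

Section Rfubini.
Context d1 d2 (T1 : measurableType d1) (T2 : measurableType d2) (R : realType).
Variables (m1 : {finite_measure set T1 -> \bar R})
          (m2 : {finite_measure set T2 -> \bar R}).
Variable f : T1 * T2 -> R.
Hypothesis intf : rintegrable (m1 \x m2)%E f.

Let mf : measurable_fun setT f.
Proof. by apply/measurable_EFinP; exact: measurable_int intf. Qed.

Lemma measurable_Rfubini1 : measurable_fun setT (fun x => \int[m2]_y f (x, y)).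
Proof.
apply: (measurableT_comp (fine_measurable measurableT)).
exact: (measurable_fubini_F intf).
Qed.

Lemma measurable_Rfubini2 : measurable_fun setT (fun y => \int[m1]_x f (x, y)).
Proof.
apply: (measurableT_comp (fine_measurable measurableT)).
exact: (measurable_fubini_G intf).
Qed.

Lemma rintegrable_Rfubini1 : rintegrable m1 (fun x => \int[m2]_y f (x, y)).
Proof.
apply: le_integrable (integrable_fubini_F intf) => //.
  exact/measurable_EFinP/measurable_Rfubini1.
by move=> x _; exact: le_abse_fine.
Qed.

Lemma Rintegral_fubini1 :
  \int[m1]_x (\int[m2]_y f (x, y)) = \int[(m1 \x m2)%E]_z f z.
Proof.
congr fine; rewrite -(integral12_prod_meas1 intf); apply: ae_eq_integral => //.
- exact/measurable_EFinP/measurable_Rfubini1.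
- exact: (measurable_fubini_F intf).
- apply: filterS (ae_integrable1 intf) => x ix _.
  by rewrite /= /Rintegral fineK//; apply: integrable_fin_num.
Qed.

Lemma Rintegral_fubini2 :
  \int[m2]_y (\int[m1]_x f (x, y)) = \int[(m1 \x m2)%E]_z f z.
Proof.
congr fine; rewrite -(integral21_prod_meas1 intf); apply: ae_eq_integral => //.
- exact/measurable_EFinP/measurable_Rfubini2.
- exact: (measurable_fubini_G intf).
- apply: filterS (ae_integrable2 intf) => x ix _.
  by rewrite /= /Rintegral fineK//; apply: integrable_fin_num.
Qed.

End Rfubini.

(** * The cosine and sine modes of the torus and their mean values *)

Section trigonometric_system.
Variable R : realType.
Local Notation mu_x := (@torus_measure R).
Implicit Types (k l : int * int) (x : R * R).

Definition cosk k x : R := cos (phase k x).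
Definition sink k x : R := sin (phase k x).

Lemma sinD2piz (a : R) (m : int) : sin (a + 2 * pi * m%:~R) = sin a.
Proof.
have sinn (n : nat) (b : R) : sin (b + 2 * pi * n%:R) = sin b.
  elim: n => [|n IH] in b *; first by rewrite mulr0 addr0.
  by rewrite -[RHS]IH -[RHS]sinD2pi -natr1; congr sin; rewrite mulr2n; ring.
case: m => n; first exact: sinn.
(* A negative shift is undone by adding the opposite positive one. *)
by rewrite -[LHS](sinn n.+1); congr sin; rewrite NegzE mulrNz; ring.
Qed.

Lemma cosD2piz (a : R) (m : int) : cos (a + 2 * pi * m%:~R) = cos a.
Proof. by rewrite -2!sinDpihalf addrAC sinD2piz. Qed.

Lemma phase0 x : phase (0, 0) x = 0.
Proof. by rewrite /phase /wavevector /=; ring. Qed.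

Lemma phaseD k l x : phase (k.1 + l.1, k.2 + l.2) x = phase k x + phase l x.
Proof. by rewrite /phase /wavevector /= !intrD; ring. Qed.

Lemma phaseN k x : phase (- k.1, - k.2) x = - phase k x.
Proof. by rewrite /phase /wavevector /= !mulrNz; ring. Qed.

Lemma phaseB k l x : phase (k.1 - l.1, k.2 - l.2) x = phase k x - phase l x.
Proof. by rewrite -phaseN -phaseD. Qed.

Lemma measurable_phase k :
  measurable_fun [set: plane R] (phase k : plane R -> R).
Proof.
rewrite /phase; apply: measurable_funD.
  by apply: measurable_funM; [exact: measurable_cst|exact: measurable_fst].
by apply: measurable_funM; [exact: measurable_cst|exact: measurable_snd].
Qed.

Lemma measurable_cosk k : measurable_fun [set: plane R] (cosk k : plane R -> R).
Proof.
apply: (@measurableT_comp _ _ _ _ _ _ (@cos R) _ (phase k)).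
  by apply: continuous_measurable_fun; exact: continuous_cos.
exact: measurable_phase.
Qed.

Lemma measurable_sink k : measurable_fun [set: plane R] (sink k : plane R -> R).
Proof.
apply: (@measurableT_comp _ _ _ _ _ _ (@sin R) _ (phase k)).
  by apply: continuous_measurable_fun; exact: continuous_sin.
exact: measurable_phase.
Qed.

Lemma sqint_cosk k : sqint mu_x (cosk k).
Proof. by apply: (@sqint_bounded _ _ _ _ _ 1); [exact: measurable_cosk|move=> x; exact: cos_max]. Qed.

Lemma sqint_sink k : sqint mu_x (sink k).
Proof. by apply: (@sqint_bounded _ _ _ _ _ 1); [exact: measurable_sink|move=> x; exact: sin_max]. Qed.

Lemma sqrt2_gt0 : 0 < Num.sqrt 2 :> R.
Proof. by rewrite sqrtr_gt0. Qed.

Lemma sqrt2_neq0 : Num.sqrt 2 != 0 :> R.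
Proof. by rewrite gt_eqF// sqrt2_gt0. Qed.

Lemma pi_neq0 : pi != 0 :> R.
Proof. by rewrite gt_eqF// pi_gt0. Qed.

(** A primitive takes the same value at 0 and L. The shift [c] stands for the other coordinate when
    a mode is integrated one coordinate at a time. *)
Lemma Rintegral_cos_full_period (L c : R) (m : int) : 0 < L -> m != 0 ->
  \int[lebesgue0 L]_y cos (2 * pi * m%:~R / L * y + c) = 0.
Proof.
move=> L0 m0; set a := _ / L.
have a0 : a != 0.
  by rewrite !mulf_neq0 ?invr_eq0 ?pi_neq0 ?intr_eq0 ?(gt_eqF L0)// pnatr_eq0.
pose F (y : R) := a^-1 * sin (a * y + c).
have <- : F L - F 0 = 0.
  rewrite /F (_ : a * L + c = c + 2 * pi * m%:~R); last first.
    by rewrite /a mulfVK ?gt_eqF// addrC.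
  by rewrite sinD2piz mulr0 add0r subrr.
apply: Rintegral_lebesgue0_derive => //.
- move=> y; apply: continuous_comp; last exact: continuous_cos.
  by apply: cvgD; [apply: cvgM; [exact: cvg_cst|exact: cvg_id]|exact: cvg_cst].
- move=> y; apply: is_derive_eq.
  by rewrite /GRing.scale /=; field.
Qed.

Lemma Rintegral_sin_full_period (L c : R) (m : int) : 0 < L -> m != 0 ->
  \int[lebesgue0 L]_y sin (2 * pi * m%:~R / L * y + c) = 0.
Proof.
move=> L0 m0; rewrite -[RHS](Rintegral_cos_full_period (c - pi / 2) L0 m0).
by apply: eq_Rintegral => y _; rewrite addrA cosBpihalf.
Qed.

Lemma torus_measureT : torus_measure [set: plane R] = (Num.sqrt 2 : R)%:E.
Proof.
rewrite /torus_measure -setXTT product_measure1E//.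
rewrite -[RHS]mule1 -(lebesgue0T (sqrtr_ge0 2)) -(lebesgue0T ler01).
by [].
Qed.

(** For nonzero [k] the inner integral is taken in a coordinate of nonzero frequency, over full
    periods, and vanishes. *)
Lemma Rintegral_sink k : \int[mu_x]_x sink k x = 0.
Proof.
have ic := sqint_rintegrable (sqint_sink k).
have [k10|k10] := eqVneq k.1 0; last first.
  rewrite -(Rintegral_fubini2 ic); under eq_Rintegral do
    rewrite /sink /phase /= Rintegral_sin_full_period ?sqrt2_gt0//.
  by rewrite Rintegral_cst// mul0r.
have [k20|k20] := eqVneq k.2 0.
  have k0 : k = (0, 0) by rewrite [LHS]surjective_pairing k10 k20.
  rewrite (@eq_Rintegral _ _ _ _ _ (fun=> 0)); last first.
    by move=> x _; rewrite /sink k0 phase0 sin0.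
  by rewrite Rintegral_cst// mul0r.
rewrite -(Rintegral_fubini1 ic).
under eq_Rintegral do under eq_Rintegral do
    rewrite /sink /phase /= addrC -[2 * pi * k.2%:~R]divr1.
under eq_Rintegral do rewrite Rintegral_sin_full_period//.
by rewrite Rintegral_cst// mul0r.
Qed.

Lemma Rintegral_cosk k :
  \int[mu_x]_x cosk k x = (k == (0, 0))%:R * Num.sqrt 2.
Proof.
have ic := sqint_rintegrable (sqint_cosk k).
have [k10|k10] := eqVneq k.1 0; last first.
  rewrite -(Rintegral_fubini2 ic); under eq_Rintegral do
    rewrite /cosk /phase /= Rintegral_cos_full_period ?sqrt2_gt0//.
  rewrite Rintegral_cst// mul0r; case: eqP => [k0|_]; last by rewrite mul0r.
  by rewrite k0 eqxx in k10.
have [k20|k20] := eqVneq k.2 0.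
  have k0 : k = (0, 0) by rewrite [LHS]surjective_pairing k10 k20.
  rewrite (@eq_Rintegral _ _ _ _ _ (fun=> 1)); last first.
    by move=> x _; rewrite /cosk k0 phase0 cos0.
  by rewrite Rintegral_cst//= torus_measureT k0 eqxx.
rewrite -(Rintegral_fubini1 ic).
under eq_Rintegral do under eq_Rintegral do
    rewrite /cosk /phase /= addrC -[2 * pi * k.2%:~R]divr1.
under eq_Rintegral do rewrite Rintegral_cos_full_period//.
rewrite Rintegral_cst// mul0r; case: eqP => [k0|_]; last by rewrite mul0r.
by rewrite k0 eqxx in k20.
Qed.

End trigonometric_system.

(** * Fourier partial sums, orthogonality and Bessel's inequality *)

Section fourier_projection.
Variable R : realType.
Local Notation mu_x := (@torus_measure R).
Implicit Types (k l : int * int) (x : R * R) (F : seq (int * int)) (f g p : R * R -> R).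

Definition oppk k : int * int := (- k.1, - k.2).

Lemma oppkK : involutive oppk.
Proof. by move=> [k1 k2]; rewrite /oppk /= !opprK. Qed.

Lemma Rintegral_torusZ c f : sqint mu_x f ->
  \int[mu_x]_x (c * f x) = c * \int[mu_x]_x f x.
Proof. by move=> sf; rewrite RintegralZl//; exact: sqint_rintegrable. Qed.

Lemma subk_eq0 k l : ((k.1 - l.1, k.2 - l.2) == (0, 0) :> (int * int)%type) = (k == l).
Proof. by case: k l => [k1 k2] [l1 l2]; rewrite !xpair_eqE !subr_eq0. Qed.

Lemma addk_eq0 k l : ((k.1 + l.1, k.2 + l.2) == (0, 0) :> (int * int)%type) = (k == oppk l).
Proof. by case: k l => [k1 k2] [l1 l2]; rewrite !xpair_eqE !addr_eq0. Qed.

Lemma cosk_mul_cosk k l x : cosk k x * cosk l x =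
  2^-1 * cosk (k.1 - l.1, k.2 - l.2) x + 2^-1 * cosk (k.1 + l.1, k.2 + l.2) x :> R.
Proof. by rewrite /cosk phaseB phaseD cosB cosD; field. Qed.

Lemma sink_mul_sink k l x : sink k x * sink l x =
  2^-1 * cosk (k.1 - l.1, k.2 - l.2) x + (- 2^-1) * cosk (k.1 + l.1, k.2 + l.2) x :> R.
Proof. by rewrite /sink /cosk phaseB phaseD cosB cosD; field. Qed.

Lemma sink_mul_cosk k l x : sink k x * cosk l x =
  2^-1 * sink (k.1 - l.1, k.2 - l.2) x + 2^-1 * sink (k.1 + l.1, k.2 + l.2) x :> R.
Proof. by rewrite /sink /cosk phaseB phaseD sinB sinD; field. Qed.

(** Modes are indexed by all of Z^2, and opposite indices give the same cosine, hence the second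
    delta. For k = l = 0 both deltas equal 1 and give the whole area sqrt 2. *)
Lemma Rintegral_cosk_cosk k l : \int[mu_x]_x (cosk k x * cosk l x) =
  Num.sqrt 2 / 2 * ((k == l)%:R + (k == oppk l)%:R).
Proof.
under eq_Rintegral do rewrite cosk_mul_cosk.
rewrite RintegralD//; [|exact/sqint_rintegrable/sqintZ/sqint_cosk..].
rewrite !Rintegral_torusZ; [|exact: sqint_cosk..].
by rewrite !Rintegral_cosk subk_eq0 addk_eq0; field.
Qed.

Lemma Rintegral_sink_sink k l : \int[mu_x]_x (sink k x * sink l x) =
  Num.sqrt 2 / 2 * ((k == l)%:R - (k == oppk l)%:R).
Proof.
under eq_Rintegral do rewrite sink_mul_sink.
rewrite RintegralD//; [|exact/sqint_rintegrable/sqintZ/sqint_cosk..].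
rewrite !Rintegral_torusZ; [|exact: sqint_cosk..].
by rewrite !Rintegral_cosk subk_eq0 addk_eq0; field.
Qed.

Lemma Rintegral_sink_cosk k l : \int[mu_x]_x (sink k x * cosk l x) = 0.
Proof.
under eq_Rintegral do rewrite sink_mul_cosk.
rewrite RintegralD//; [|exact/sqint_rintegrable/sqintZ/sqint_sink..].
rewrite !Rintegral_torusZ; [|exact: sqint_sink..].
by rewrite !Rintegral_sink; ring.
Qed.

Definition coscoef f k : R := \int[mu_x]_x (f x * cosk k x).
Definition sincoef f k : R := \int[mu_x]_x (f x * sink k x).

Lemma coscoefN f k : coscoef f (oppk k) = coscoef f k.
Proof. by apply: eq_Rintegral => x _; rewrite /cosk phaseN cosN. Qed.

Lemma sincoefN f k : sqint mu_x f -> sincoef f (oppk k) = - sincoef f k.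
Proof.
move=> sf; rewrite /sincoef -mulN1r -RintegralZl//; last first.
  by apply: sqint_mul => //; exact: sqint_sink.
by apply: eq_Rintegral => x _; rewrite /sink phaseN sinN; ring.
Qed.

(** The real part of the sum over [F] of [fourier f k] times e^(i xi_k . x); the imaginary parts
    cancel when [F] is symmetric. The prefactor is the inverse of the area. *)
Definition fourier_sum F f x : R :=
  (Num.sqrt 2)^-1 *
    \sum_(k <- F) (coscoef f k * cosk k x + sincoef f k * sink k x).

(** The area of the torus times the sum over [F] of the squared moduli of [fourier f k]. *)
Definition fourier_energy F f : R :=
  (Num.sqrt 2)^-1 * \sum_(k <- F) (coscoef f k ^+ 2 + sincoef f k ^+ 2).

(** By symmetry each mode is met twice, as [k] and as [oppk k], which compensates the factor 1/2 in
    the orthogonality relations. *)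
Definition sym_modes F := uniq F /\ forall k, k \in F -> oppk k \in F.

Lemma sqint_trig_sum F (a b : int * int -> R) :
  sqint mu_x (fun x => \sum_(k <- F) (a k * cosk k x + b k * sink k x)).
Proof.
apply: sqint_sum => k _.
by apply: sqintD; apply: sqintZ; [exact: sqint_cosk|exact: sqint_sink].
Qed.

Lemma sqint_fourier_sum F f : sqint mu_x (fourier_sum F f).
Proof. by apply: sqintZ; exact: sqint_trig_sum. Qed.

Lemma Rintegral_trig_sum F (a b : int * int -> R) g : sqint mu_x g ->
  \int[mu_x]_x ((\sum_(k <- F) (a k * cosk k x + b k * sink k x)) * g x) =
  \sum_(k <- F) (a k * coscoef g k + b k * sincoef g k).
Proof.
move=> sg; under eq_Rintegral do rewrite mulr_suml.
have sk k : sqint mu_x (fun x => a k * cosk k x + b k * sink k x).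
  by apply: sqintD; apply: sqintZ; [exact: sqint_cosk|exact: sqint_sink].
rewrite Rintegral_sum; last by move=> k _; exact: sqint_mul.
apply: eq_bigr => k _.
have ic : rintegrable mu_x (fun x => g x * cosk k x).
  by apply: sqint_mul => //; exact: sqint_cosk.
have is_ : rintegrable mu_x (fun x => g x * sink k x).
  by apply: sqint_mul => //; exact: sqint_sink.
rewrite -!RintegralZl// -RintegralD//; try exact: rintegrableZ.
by apply: eq_Rintegral => x _; ring.
Qed.

Lemma Rintegral_fourier_sum F f g : sqint mu_x g ->
  \int[mu_x]_x (fourier_sum F f x * g x) =
  (Num.sqrt 2)^-1 *
    \sum_(k <- F) (coscoef f k * coscoef g k + sincoef f k * sincoef g k).
Proof.
move=> sg; rewrite -Rintegral_trig_sum// -RintegralZl//; last first.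
  by apply: sqint_mul => //; exact: sqint_trig_sum.
by apply: eq_Rintegral => x _; rewrite -mulrA.
Qed.

Lemma fourier_sum_energy F f : sqint mu_x f ->
  \int[mu_x]_x (fourier_sum F f x * f x) = fourier_energy F f.
Proof. by move=> sf; rewrite Rintegral_fourier_sum. Qed.

Lemma sum_delta (F : seq (int * int)) (c : int * int -> R) l :
  uniq F -> l \in F -> \sum_(k <- F) c k * (l == k)%:R = c l.
Proof.
move=> uF lF; rewrite (bigD1_seq l)//= eqxx mulr1 big1 ?addr0// => k kl.
by rewrite eq_sym (negbTE kl) mulr0.
Qed.

Lemma sum_delta_opp F (c : int * int -> R) l :
  sym_modes F -> l \in F -> \sum_(k <- F) c k * (l == oppk k)%:R = c (oppk l).
Proof.
move=> [uF sF] lF; rewrite -(sum_delta c uF (sF _ lF)).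
by apply: eq_bigr => k _; rewrite (can2_eq oppkK oppkK).
Qed.

Lemma coscoef_fourier_sum F f l : sqint mu_x f -> sym_modes F -> l \in F ->
  coscoef (fourier_sum F f) l = coscoef f l.
Proof.
move=> sf sF lF; rewrite {1}/coscoef Rintegral_fourier_sum; last exact: sqint_cosk.
under eq_bigr => k _.
  have -> : sincoef (cosk l) k = 0.
    by rewrite -[RHS](Rintegral_sink_cosk k l); apply: eq_Rintegral => x _; rewrite mulrC.
  rewrite mulr0 addr0 [coscoef (cosk l) k]Rintegral_cosk_cosk mulrCA mulrDr.
over.
rewrite -mulr_sumr big_split /= sum_delta_opp// sum_delta//; last by case: sF.
by rewrite coscoefN; field; exact: sqrt2_neq0.
Qed.

Lemma sincoef_fourier_sum F f l : sqint mu_x f -> sym_modes F -> l \in F ->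
  sincoef (fourier_sum F f) l = sincoef f l.
Proof.
move=> sf sF lF; rewrite {1}/sincoef Rintegral_fourier_sum; last exact: sqint_sink.
under eq_bigr => k _.
  rewrite [coscoef (sink l) k]Rintegral_sink_cosk.
  rewrite mulr0 add0r [sincoef (sink l) k]Rintegral_sink_sink mulrCA mulrBr.
over.
rewrite -mulr_sumr sumrB sum_delta_opp// sum_delta//; last by case: sF.
by rewrite sincoefN//; field; exact: sqrt2_neq0.
Qed.

Lemma fourier_sum_sqnorm F f : sqint mu_x f -> sym_modes F ->
  \int[mu_x]_x (fourier_sum F f x * fourier_sum F f x) = fourier_energy F f.
Proof.
move=> sf sF; rewrite Rintegral_fourier_sum; last exact: sqint_fourier_sum.
congr (_ * _); apply: eq_big_seq => k kF.
by rewrite coscoef_fourier_sum// sincoef_fourier_sum.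
Qed.

Definition residual F f x := f x - fourier_sum F f x.

Lemma sqint_residual F f : sqint mu_x f -> sqint mu_x (residual F f).
Proof. by move=> sf; apply: sqintB => //; exact: sqint_fourier_sum. Qed.

Lemma residual_cosk F f l : sqint mu_x f -> sym_modes F -> l \in F ->
  \int[mu_x]_x (residual F f x * cosk l x) = 0.
Proof.
move=> sf sF lF; under eq_Rintegral do rewrite /residual mulrBl.
rewrite RintegralB//; try by apply: sqint_mul;
  [try exact: sqint_fourier_sum|exact: sqint_cosk].
by apply/eqP; rewrite subr_eq0 -/(coscoef f l) -(coscoef_fourier_sum sf sF).
Qed.

Lemma residual_sink F f l : sqint mu_x f -> sym_modes F -> l \in F ->
  \int[mu_x]_x (residual F f x * sink l x) = 0.
Proof.
move=> sf sF lF; under eq_Rintegral do rewrite /residual mulrBl.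
rewrite RintegralB//; try by apply: sqint_mul;
  [try exact: sqint_fourier_sum|exact: sqint_sink].
by apply/eqP; rewrite subr_eq0 -/(sincoef f l) -(sincoef_fourier_sum sf sF).
Qed.

Lemma residual_fourier_sum F f : sqint mu_x f -> sym_modes F ->
  \int[mu_x]_x (residual F f x * fourier_sum F f x) = 0.
Proof.
move=> sf sF; under eq_Rintegral do rewrite /residual mulrBl.
have sS := sqint_fourier_sum F f.
rewrite RintegralB//; try exact: sqint_mul.
rewrite fourier_sum_sqnorm// -fourier_sum_energy//; apply/eqP.
by rewrite subr_eq0; apply/eqP; apply: eq_Rintegral => x _; rewrite mulrC.
Qed.

(** Pythagoras: the residual is orthogonal to the partial sum. *)
Lemma residual_sqnorm F f : sqint mu_x f -> sym_modes F ->
  \int[mu_x]_x (residual F f x ^+ 2) = \int[mu_x]_x (f x ^+ 2) - fourier_energy F f.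
Proof.
move=> sf sF; have sS := sqint_fourier_sum F f.
transitivity (\int[mu_x]_x (f x ^+ 2 - fourier_sum F f x * f x
                            - residual F f x * fourier_sum F f x)).
  by apply: eq_Rintegral => x _; rewrite /residual; ring.
have i1 : rintegrable mu_x (fun x => f x ^+ 2) by case: sf.
have i2 := sqint_mul sS sf.
rewrite RintegralB//; last by apply: sqint_mul => //; exact: sqint_residual.
  by rewrite RintegralB// residual_fourier_sum// fourier_sum_energy// subr0.
exact: rintegrableB.
Qed.

Lemma bessel F f : sqint mu_x f -> sym_modes F ->
  fourier_energy F f <= \int[mu_x]_x (f x ^+ 2).
Proof.
move=> sf sF; rewrite -subr_ge0 -residual_sqnorm//.
by apply: Rintegral_ge0 => x _; exact: sqr_ge0.
Qed.

(** Write r for the residual and S for the partial sum. As r is orthogonal to S and to p, the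
    squared norm of f - p is that of r plus that of S - p. *)
Lemma residual_best F f p : sqint mu_x f -> sqint mu_x p -> sym_modes F ->
  \int[mu_x]_x (residual F f x * p x) = 0 ->
  \int[mu_x]_x (f x ^+ 2) - fourier_energy F f <= \int[mu_x]_x ((f x - p x) ^+ 2).
Proof.
move=> sf sp sF fp0; have sS := sqint_fourier_sum F f.
have sr := sqint_residual F sf.
have i1 := sqint_mul sr sS; have i2 := sqint_mul sr sp.
rewrite -residual_sqnorm//.
(* Adding terms of zero integral makes the comparison pointwise: the integrands then differ by (S -
   p)^2. *)
have -> : \int[mu_x]_x (residual F f x ^+ 2) = \int[mu_x]_x (residual F f x ^+ 2
    + 2 * (residual F f x * fourier_sum F f x - residual F f x * p x)).
  rewrite RintegralD//; [|by case: sr|exact/rintegrableZ/rintegrableB].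
  rewrite RintegralZl//; last exact/rintegrableB.
  by rewrite RintegralB// fp0 residual_fourier_sum// subrr mulr0 addr0.
apply: le_Rintegral => //.
- by apply: rintegrableD; [case: sr|exact/rintegrableZ/rintegrableB].
- by case: (sqintB sf sp).
- move=> x _; rewrite /residual -subr_ge0.
  rewrite (_ : _ - _ = (fourier_sum F f x - p x) ^+ 2) ?sqr_ge0//; ring.
Qed.

Definition box (n : nat) : seq (int * int) :=
  let r := [seq (i%:Z - n%:Z) | i <- iota 0 n.*2.+1] in
  [seq (i, j) | i <- r, j <- r].

Lemma mem_box n k : (k \in box n) = (`|k.1|%N <= n)%N && (`|k.2|%N <= n)%N.
Proof.
have memr (m : int) :
    (m \in [seq (i%:Z - n%:Z) | i <- iota 0 n.*2.+1]) = (`|m|%N <= n)%N.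
  apply/mapP/idP => [[a]|mn].
    by rewrite mem_iota => /andP[_]; rewrite add0n => ilt ->; lia.
  by exists (absz (m + n%:Z)); [rewrite mem_iota; lia|lia].
case: k => i j; rewrite -!memr; apply/allpairsP/andP => /=.
  by move=> [[i0 j0] [? ? [-> ->]]].
by move=> [ir jr]; exists (i, j).
Qed.

Lemma sym_box n : sym_modes (box n).
Proof.
split; last by move=> k; rewrite !mem_box /= !abszN.
have ur : uniq [seq (i%:Z - n%:Z) | i <- iota 0 n.*2.+1].
  by rewrite map_inj_uniq ?iota_uniq// => i j; lia.
by apply: allpairs_uniq => // -[? ?] [? ?] _ _ [-> ->].
Qed.

Lemma sub_box m n : (m <= n)%N -> {subset box m <= box n}.
Proof. by move=> mn k; rewrite !mem_box => /andP[? ?]; lia. Qed.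

(** The predicate does not record which modes occur; [residual_trigpoly] recovers a bound on the
    degree by induction. *)
Inductive trigpoly : (R * R -> R) -> Prop :=
| trig_cos c k : trigpoly (fun x => c * cosk k x)
| trig_sin c k : trigpoly (fun x => c * sink k x)
| trig_add p q : trigpoly p -> trigpoly q -> trigpoly (fun x => p x + q x).

Lemma trigpoly_sqint p : trigpoly p -> sqint mu_x p.
Proof.
elim=> [c k|c k|{}p q _ sp _ sq].
- by apply: sqintZ; exact: sqint_cosk.
- by apply: sqintZ; exact: sqint_sink.
- exact: sqintD.
Qed.

Lemma trigpoly_bounded p : trigpoly p -> exists M, forall x, `|p x| <= M.
Proof.
elim=> [c k|c k|{}p q _ [M pM] _ [M' qM']].
- exists `|c| => x; rewrite normrM -[leRHS]mulr1 ler_wpM2l//; exact: cos_max.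
- exists `|c| => x; rewrite normrM -[leRHS]mulr1 ler_wpM2l//; exact: sin_max.
- by exists (M + M') => x; rewrite (le_trans (ler_normD _ _))// lerD.
Qed.

(** A box containing all modes of [p] makes the residual orthogonal to [p]; the threshold depends on
    [p] only. *)
Lemma residual_trigpoly p : trigpoly p -> exists n, forall m f, (n <= m)%N ->
  sqint mu_x f -> \int[mu_x]_x (residual (box m) f x * p x) = 0.
Proof.
have inbox (k : int * int) m : (maxn `|k.1|%N `|k.2|%N <= m)%N -> k \in box m.
  by rewrite geq_max mem_box.
elim=> [c k|c k|{}p q tp [n1 pn1] tq [n2 qn2]].
- exists (maxn `|k.1|%N `|k.2|%N) => m f /inbox km sf.
  under eq_Rintegral do rewrite mulrCA.
  rewrite RintegralZl//; last first.
    by apply: sqint_mul; [exact: sqint_residual|exact: sqint_cosk].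
  by rewrite residual_cosk ?mulr0//; exact: sym_box.
- exists (maxn `|k.1|%N `|k.2|%N) => m f /inbox km sf.
  under eq_Rintegral do rewrite mulrCA.
  rewrite RintegralZl//; last first.
    by apply: sqint_mul; [exact: sqint_residual|exact: sqint_sink].
  by rewrite residual_sink ?mulr0//; exact: sym_box.
- exists (maxn n1 n2) => m f; rewrite geq_max => /andP[n1m n2m] sf.
  under eq_Rintegral do rewrite mulrDr.
  have sr := sqint_residual (box m) sf.
  rewrite RintegralD ?pn1 ?qn2 ?addr0//.
    by apply: sqint_mul => //; exact: trigpoly_sqint.
  by apply: sqint_mul => //; exact: trigpoly_sqint.
Qed.

Lemma trigpolyZ c p : trigpoly p -> trigpoly (fun x => c * p x).
Proof.
elim=> [d k|d k|{}p q _ tp _ tq].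
- by under eq_fun do rewrite mulrA; exact: trig_cos.
- by under eq_fun do rewrite mulrA; exact: trig_sin.
- by under eq_fun do rewrite mulrDr; exact: trig_add.
Qed.

Lemma trigpoly_cst c : trigpoly (fun=> c).
Proof.
have := trig_cos c (0, 0); congr trigpoly; apply/funext => x.
by rewrite /cosk phase0 cos0 mulr1.
Qed.

(** The product-to-sum formulas, inside a double induction. *)
Lemma trigpolyM p q : trigpoly p -> trigpoly q -> trigpoly (fun x => p x * q x).
Proof.
move=> + tq; elim=> [c k|c k|{}p p1 _ tp _ tp1]; last first.
- by under eq_fun do rewrite mulrDl; exact: trig_add.
- under eq_fun do rewrite -mulrA; apply: trigpolyZ.
  elim: tq => [d l|d l|{}q q1 _ tq _ tq1]; last first.
  + by under eq_fun do rewrite mulrDr; exact: trig_add.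
  + under eq_fun do rewrite mulrCA sink_mul_sink; apply: trigpolyZ.
    by apply: trig_add; exact: trig_cos.
  + under eq_fun do rewrite mulrCA sink_mul_cosk; apply: trigpolyZ.
    by apply: trig_add; exact: trig_sin.
- under eq_fun do rewrite -mulrA; apply: trigpolyZ.
  elim: tq => [d l|d l|{}q q1 _ tq _ tq1]; last first.
  + by under eq_fun do rewrite mulrDr; exact: trig_add.
  + under eq_fun do rewrite mulrCA [cosk _ _ * _]mulrC sink_mul_cosk.
    by apply: trigpolyZ; apply: trig_add; exact: trig_sin.
  + under eq_fun do rewrite mulrCA cosk_mul_cosk; apply: trigpolyZ.
    by apply: trig_add; exact: trig_cos.
Qed.

Lemma trigpolyX p n : trigpoly p -> trigpoly (fun x => p x ^+ n).
Proof.
move=> tp; elim: n => [|n IH]; first exact: trigpoly_cst.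
by under eq_fun do rewrite exprS; exact: trigpolyM.
Qed.

End fourier_projection.

(** * Polynomials on [0, 1] steepening at 1/2 *)

Section step_polynomials.
Variable R : realType.
Implicit Types q y x : R.

Lemma bernoulli_ineq (n : nat) y : -1 <= y -> 1 + n%:R * y <= (1 + y) ^+ n.
Proof.
move=> y1; elim: n => [|n IH]; first by rewrite mul0r addr0.
rewrite exprS; apply: (@le_trans _ _ ((1 + y) * (1 + n%:R * y))).
  rewrite -natr1 -subr_ge0.
  rewrite (_ : _ - _ = n%:R * y ^+ 2); last ring.
  by rewrite mulr_ge0// sqr_ge0.
by apply: ler_wpM2l => //; lra.
Qed.

(** The polynomial from elementary proofs of the Stone-Weierstrass theorem. The exponents n and 2^n
    put the threshold at 1/2, since 2^n q^n = (2 q)^n. *)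
Definition step_poly n q := 1 - (1 - q ^+ n) ^+ (2 ^ n).

Lemma step_poly_itv n q : 0 <= q <= 1 -> 0 <= step_poly n q <= 1.
Proof.
move=> /andP[q0 q1].
have qn : 0 <= 1 - q ^+ n <= 1 by rewrite subr_ge0 exprn_ile1//= lerBlDr lerDl exprn_ge0.
case/andP: qn => qn0 qn1.
have := exprn_ge0 (2 ^ n) qn0; have := exprn_ile1 (2 ^ n) qn0 qn1.
by rewrite /step_poly; lra.
Qed.

(** Bernoulli's inequality bounds [step_poly n q] by (2 q)^n. *)
Lemma step_poly_cvg0 q : 0 <= q < 2^-1 -> step_poly n q @[n --> \oo] --> (0 : R).
Proof.
move=> /andP[q0 q1].
apply: (@squeeze_cvgr _ _ _ _ (fun=> 0) (fun n => (2 * q) ^+ n)).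
- apply: nearW => n; have q01 : 0 <= q <= 1 by lra.
  have /andP[-> _] := step_poly_itv n q01; rewrite /step_poly lerBlDr -lerBlDl.
  have qn : q ^+ n <= 1 by apply: exprn_ile1 => //; lra.
  have := @bernoulli_ineq (2 ^ n) (- q ^+ n); rewrite lerN2 => /(_ qn).
  by rewrite mulrN exprMn natrX.
- exact: cvg_cst.
- apply: cvg_expr; rewrite ger0_norm; lra.
Qed.

(** By Bernoulli (2 q)^n <= (1 + q^n)^(2^n), so (1 - q^n)^(2^n) (2 q)^n <= (1 - q^(2 n))^(2^n) <=
    1. *)
Lemma step_poly_cvg1 q : 2^-1 < q <= 1 -> step_poly n q @[n --> \oo] --> (1 : R).
Proof.
move=> /andP[q0 q1].
apply: (@squeeze_cvgr _ _ _ _ (fun n => 1 - (2 * q)^-1 ^+ n) (fun=> 1)).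
- apply: nearW => n; have q01 : 0 <= q <= 1 by lra.
  have /andP[_ ->] := step_poly_itv n q01; rewrite /step_poly andbT lerD2l lerN2.
  have qn : 0 <= q ^+ n by apply: exprn_ge0; lra.
  have qn1 : q ^+ n <= 1 by apply: exprn_ile1; lra.
  have dq : 0 < (2 * q) ^+ n by apply: exprn_gt0; lra.
  rewrite exprVn -[leRHS]mul1r ler_pdivlMr//.
  apply: (@le_trans _ _ ((1 - q ^+ n) ^+ (2 ^ n) * (1 + q ^+ n) ^+ (2 ^ n))).
    apply: ler_wpM2l; first by apply: exprn_ge0; lra.
    apply: le_trans (bernoulli_ineq _ _); last lra.
    by rewrite natrX -exprMn lerDr.
  rewrite -exprMn; apply: exprn_ile1; last nra.
  by apply: mulr_ge0; lra.
- rewrite -[X in _ --> X]subr0; apply: cvgB; first exact: cvg_cst.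
  apply: cvg_expr; rewrite ger0_norm ?invr_ge0; last lra.
  by rewrite invf_lt1; lra.
- exact: cvg_cst.
Qed.

Lemma cos_gt_arc (d y : R) : 0 < d < pi -> - d < y < d -> cos d < cos y.
Proof.
move=> /andP[d0 dpi] /andP[y1 y2].
have yd : `|y| < d by rewrite ltr_norml y1.
have dI : d \in `[0, pi] by rewrite in_itv/= !ltW.
have yI : `|y| \in `[0, pi] by rewrite in_itv/= normr_ge0 ltW// (lt_trans yd).
by rewrite -(cos_norm y) ltr_cos.
Qed.

(** Parity for y >= - pi and translation by 2 pi for y < - pi bring the angle into [0, pi], where
    cos decreases. *)
Lemma cos_lt_arc (d y : R) : 0 < d < pi -> - 2 * pi + d < y < - d -> cos y < cos d.
Proof.
move=> /andP[d0 dpi] /andP[y1 y2].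
have dI : d \in `[0, pi] by rewrite in_itv/= !ltW.
have [ypi|ypi] := leP (- pi) y.
  have yI : - y \in `[0, pi] by rewrite in_itv/=; apply/andP; split; lra.
  by rewrite -(cosN y) ltr_cos//; lra.
have yI : y + pi *+ 2 \in `[0, pi].
  by rewrite in_itv/= mulr2n; apply/andP; split; lra.
by rewrite -(cosD2pi y) ltr_cos// mulr2n; lra.
Qed.

End step_polynomials.

(** * The L^2 closure of the trigonometric polynomials *)

Section density.
Variable R : realType.
Local Notation mu_x := (@torus_measure R).
Implicit Types (f g p : R * R -> R) (A B : set (R * R)).

Definition approximable f := forall e, 0 < e ->
  exists p, trigpoly p /\ \int[mu_x]_x ((f x - p x) ^+ 2) <= e.

Lemma sqnormD f g : sqint mu_x f -> sqint mu_x g ->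
  \int[mu_x]_x ((f x + g x) ^+ 2) <=
  2 * \int[mu_x]_x (f x ^+ 2) + 2 * \int[mu_x]_x (g x ^+ 2).
Proof.
move=> sf sg; have [_ if2] := sf; have [_ ig2] := sg.
rewrite -!RintegralZl// -RintegralD//; [|exact: rintegrableZ..].
apply: le_Rintegral => //.
- by case: (sqintD sf sg).
- by apply: rintegrableD; exact: rintegrableZ.
- by move=> x _; rewrite -subr_ge0 (_ : _ - _ = (f x - g x) ^+ 2) ?sqr_ge0//; ring.
Qed.

Lemma approximable_trigpoly p : trigpoly p -> approximable p.
Proof.
move=> tp e e0; exists p; split => //; under eq_Rintegral do rewrite subrr expr0n/=.
by rewrite Rintegral_cst// mul0r ltW.
Qed.

Lemma approximable_lim f : sqint mu_x f ->
  (forall e, 0 < e -> exists g, [/\ sqint mu_x g, approximable g &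
    \int[mu_x]_x ((f x - g x) ^+ 2) <= e]) -> approximable f.
Proof.
(* [sqnormD] doubles both squared errors, and 2 (e / 4) + 2 (e / 4) = e. *)
move=> sf fg e e0; have e4 : 0 < e / 4 by lra.
have [g [sg ag fge]] := fg _ e4.
have [p [tp gpe]] := ag _ e4; exists p; split => //.
have sp := trigpoly_sqint tp.
have := sqnormD (sqintB sf sg) (sqintB sg sp).
under eq_Rintegral do rewrite addrA subrK.
by move=> /le_trans; apply; lra.
Qed.

Lemma approximableD f g : sqint mu_x f -> sqint mu_x g ->
  approximable f -> approximable g -> approximable (fun x => f x + g x).
Proof.
move=> sf sg af ag e e0; have e4 : 0 < e / 4 by lra.
have [p [tp fpe]] := af _ e4; have [q [tq gqe]] := ag _ e4.
exists (fun x => p x + q x); split; first exact: trig_add.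
have := sqnormD (sqintB sf (trigpoly_sqint tp)) (sqintB sg (trigpoly_sqint tq)).
under eq_Rintegral do rewrite addrACA -opprD.
by move=> /le_trans; apply; lra.
Qed.

Lemma sqnorm_mul_bounded f g M : measurable_fun [set: plane R] (f : plane R -> R) ->
  (forall x, `|f x| <= M) ->
  sqint mu_x g ->
  \int[mu_x]_x ((f x * g x) ^+ 2) <= M ^+ 2 * \int[mu_x]_x (g x ^+ 2).
Proof.
move=> mf fM sg; have [_ ig2] := sg; rewrite -RintegralZl//.
apply: le_Rintegral => //.
- by case: (sqintM_bounded mf fM sg).
- exact: rintegrableZ.
- move=> x _; rewrite exprMn ler_wpM2r ?sqr_ge0//.
  by rewrite -(real_normK (num_real (f x))) lerXn2r// ?nnegrE// (le_trans _ (fM x)).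
Qed.

Lemma approximable_mul_dist f g M : measurable_fun [set: plane R] (f : plane R -> R) ->
  (forall x, `|f x| <= M) ->
  sqint mu_x g -> approximable g ->
  (forall p, trigpoly p -> approximable (fun x => f x * p x)) ->
  approximable (fun x => f x * g x).
Proof.
move=> mf fM sg ag fp; apply: approximable_lim; first exact: sqintM_bounded sg.
(* M^2 + 1 avoids a division by 0 and still dominates M^2. *)
move=> e e0; have e1 : 0 < e / (M ^+ 2 + 1).
  by rewrite divr_gt0// ltr_wpDl// sqr_ge0.
have [p [tp gpe]] := ag _ e1; have sp := trigpoly_sqint tp.
exists (fun x => f x * p x); split; [exact: sqintM_bounded sp|exact: fp|].
under eq_Rintegral do rewrite -mulrBr.
apply: le_trans (sqnorm_mul_bounded mf fM (sqintB sg sp)) _.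
have := sqr_ge0 M => M0.
apply: le_trans (ler_wpM2l M0 gpe) _.
by rewrite mulrCA ger_pMr// ler_pdivrMr ?ltr_wpDl// mul1r; lra.
Qed.

(** First [g] is replaced by a polynomial p, the factor [f] being bounded; then [f] is replaced, p
    being bounded. A product of two polynomials remains. *)
Lemma approximableM f g M : measurable_fun [set: plane R] (f : plane R -> R) ->
  (forall x, `|f x| <= M) -> approximable f ->
  sqint mu_x g -> approximable g -> approximable (fun x => f x * g x).
Proof.
move=> mf fM af sg ag; apply: (approximable_mul_dist mf fM) => // p tp.
have [N pN] := trigpoly_bounded tp.
under eq_fun do rewrite mulrC.
apply: (approximable_mul_dist _ pN) => //.
- by case: (trigpoly_sqint tp).
- exact: sqint_bounded mf fM.
- by move=> q tq; apply: approximable_trigpoly; exact: trigpolyM.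
Qed.

Lemma approximableZ c f : sqint mu_x f -> approximable f ->
  approximable (fun x => c * f x).
Proof.
move=> sf af; apply: (@approximableM (fun=> c) f `|c|) => //.
exact/approximable_trigpoly/trigpoly_cst.
Qed.

Lemma approximable_dominated (f_ : nat -> R * R -> R) f h :
  (forall n, measurable_fun [set: plane R] (f_ n : plane R -> R)) ->
  (forall n, approximable (f_ n)) ->
  measurable_fun [set: plane R] (f : plane R -> R) -> sqint mu_x h ->
  (forall n x, `|f_ n x| <= h x) -> (forall x, `|f x| <= h x) ->
  (\forall x \ae (mu_x : {finite_measure set (plane R) -> \bar R}), f_ n x @[n --> \oo] --> f x) ->
  approximable f.
Proof.
move=> mf_ af_ mf [mh ih] f_h fh ff.
have sq g : measurable_fun [set: plane R] (g : plane R -> R) ->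
    (forall x, `|g x| <= h x) -> sqint mu_x g.
  move=> mg gh; split => //; apply: rintegrable_le ih _ => /=.
    exact: measurable_funX.
  by move=> x; rewrite normrX lerXn2r// ?nnegrE// (le_trans _ (gh x)).
apply: approximable_lim; first exact: sq.
move=> e e0.
have : \int[mu_x]_x ((f x - f_ n x) ^+ 2) @[n --> \oo] --> \int[mu_x]_x (0 : R).
  (* The difference of two functions bounded by h is at most 2 h in modulus. *)
  apply: (@Rintegral_dominated _ _ _ _ _ _ (fun x => 4 * h x ^+ 2)) => //.
  - by move=> n; apply: measurable_funX; apply: measurable_funB.
  - move: ff; apply: ae_imply => x fx.
    have fx0 : f x - f_ n x @[n --> \oo] --> 0.
      by rewrite -(subrr (f x)); apply: cvgB => //; exact: cvg_cst.
    by rewrite -[X in _ --> X](mulr0 0); exact: (cvgM fx0 fx0).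
  - exact: rintegrableZ.
  - apply: aeW => x n; rewrite ger0_norm ?sqr_ge0//.
    have := f_h n x; have := fh x; rewrite !ler_norml; nra.
rewrite Rintegral_cst// mul0r => /cvgr_dist_lt /(_ _ e0) [N _ /(_ N (leqnn _))] /=.
rewrite sub0r normrN => eN; exists (f_ N); split; [exact: sq|exact: af_|].
exact: le_trans (ler_norm _) (ltW eN).
Qed.

End density.

(** * Density in L^2 and Parseval's identity *)

Section density_of_trigonometric_polynomials.
Variable R : realType.
Local Notation mu_x := (@torus_measure R).
Implicit Types (f g p : R * R -> R) (A B : set (plane R)).

Definition approximable_set A :=
  measurable A /\ approximable (\1_A : plane R -> R).

Lemma indic_bounded A x : `|\1_A x : R| <= 1.
Proof. by rewrite indicE; case: (_ \in _); rewrite ?normr1 ?normr0. Qed.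

Lemma sqint_indic A : measurable A -> sqint mu_x (\1_A : plane R -> R).
Proof.
move=> mA; apply: (@sqint_bounded _ _ _ _ _ 1).
  exact: measurable_indic.
exact: indic_bounded.
Qed.

Lemma approximable_setI A B : approximable_set A -> approximable_set B ->
  approximable_set (A `&` B).
Proof.
move=> [mA aA] [mB aB]; split; first exact: measurableI.
rewrite indicI; apply: (@approximableM _ _ _ 1) => //.
- exact: indic_bounded.
- exact: sqint_indic.
Qed.

Lemma approximable_setC A : approximable_set A -> approximable_set (~` A).
Proof.
move=> [mA aA]; split; first exact: measurableC.
have : approximable (fun x : plane R => 1 + (-1) * \1_A x : R).
  apply: approximableD.
  - exact: sqint_cst.
  - by apply: sqintZ; exact: sqint_indic.
  - exact/approximable_trigpoly/trigpoly_cst.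
  - by apply: approximableZ => //; exact: sqint_indic.
congr approximable; apply/funext => x.
by rewrite !indicE in_setC; case: (_ \in _) => /=; lra.
Qed.

Lemma approximable_set0 : approximable_set set0.
Proof.
split => //; rewrite indic0.
exact/approximable_trigpoly/trigpoly_cst.
Qed.

Lemma approximable_setU A B : approximable_set A -> approximable_set B ->
  approximable_set (A `|` B).
Proof.
move=> aA aB; rewrite -[A `|` B]setCK setCU.
by apply/approximable_setC/approximable_setI; exact: approximable_setC.
Qed.

(** The indicators of the finite unions are dominated by 1 and converge pointwise to that of the
    whole union. *)
Lemma approximable_bigcup (F : nat -> set (plane R)) :
  (forall n, approximable_set (F n)) -> approximable_set (\bigcup_n F n).
Proof.
move=> aF; split; first by apply: bigcupT_measurable => n; case: (aF n).
have aG n : approximable_set (\big[setU/set0]_(i < n) F i).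
  elim: n => [|n IH]; first by rewrite big_ord0; exact: approximable_set0.
  by rewrite big_ord_recr; exact: approximable_setU.
apply: (@approximable_dominated _ (fun n => \1_(\big[setU/set0]_(i < n) F i)) _
  (fun=> 1)) => //.
- by move=> n; apply: measurable_indic; case: (aG n).
- by move=> n; case: (aG n).
- by apply: measurable_indic; apply: bigcupT_measurable => n; case: (aF n).
- exact: sqint_cst.
- by move=> n x; exact: indic_bounded.
- by move=> x; exact: indic_bounded.
- apply: aeW => x; have [[n _ Fnx]|nFx] := pselect ((\bigcup_n F n) x).
    apply: cvg_near_cst; exists n.+1 => // m /= nm.
    rewrite !indicE !mem_set//; first by exists n.
    by rewrite -bigcup_mkord; exists n.
  apply: cvg_near_cst; apply: nearW => m; rewrite !indicE !memNset//.
  by rewrite -bigcup_mkord => -[n _ Fnx]; apply: nFx; exists n.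
Qed.

Lemma sigma_algebra_approximable : sigma_algebra setT approximable_set.
Proof.
split; [exact: approximable_set0| |exact: approximable_bigcup].
by move=> A; rewrite setTD; exact: approximable_setC.
Qed.

(* On (0, L), the trigonometric polynomial [q] exceeds 1/2 exactly beyond [a]: with
   angles theta = 2 pi y / L, the ray y > a is an arc centred at pi (1 + a / L). *)
Lemma ray_profile (L a : R) : 0 < a < L -> exists c0 c1 c2 : R,
  forall y, let t := 2 * pi / L * y in
  let q := c0 + c1 * cos t + c2 * sin t in
  0 <= q <= 1 /\ (0 < y < L -> (a < y -> 2^-1 < q) /\ (y < a -> q < 2^-1)).
Proof.
move=> /andP[a0 aL]; pose tm : R := pi * (1 + a / L); pose d : R := pi * (1 - a / L).
have L0 : 0 < L by lra.
have pi0 := pi_gt0 R.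
have aL0 : 0 < a / L by rewrite divr_gt0.
have aL1 : a / L < 1 by rewrite ltr_pdivrMr// mul1r.
have dI : 0 < d < pi by rewrite /d; apply/andP; split; nra.
(* These coefficients give q = 1/2 + (cos (t - tm) - cos d) / 4, where [d] is the half-length of the
   arc. The factor 1/4 keeps q in [0, 1]. *)
exists (2^-1 - cos d / 4), (cos tm / 4), (sin tm / 4) => y t q.
have qE : q = 2^-1 + (cos (t - tm) - cos d) / 4 by rewrite /q cosB; field.
have tE : t = 2 * pi * (y / L) by rewrite /t; field; rewrite gt_eqF.
rewrite qE; split.
  have := cos_le1 (t - tm); have := cos_geN1 (t - tm).
  by have := cos_le1 d; have := cos_geN1 d; lra.
move=> /andP[y0 yL].
have yL0 : 0 < y / L by rewrite divr_gt0.
have yL1 : y / L < 1 by rewrite ltr_pdivrMr// mul1r.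
split.
- move=> ay; have ayL : a / L < y / L by rewrite ltr_pM2r ?invr_gt0.
  suff : cos d < cos (t - tm) by lra.
  by apply: cos_gt_arc => //; rewrite tE /tm /d; apply/andP; split; nra.
- move=> ay; have ayL : y / L < a / L by rewrite ltr_pM2r ?invr_gt0.
  suff : cos (t - tm) < cos d by lra.
  by apply: cos_lt_arc => //; rewrite tE /tm /d; apply/andP; split; nra.
Qed.

(** The trigonometric polynomials [step_poly n (q x)] lie in [0, 1] and tend to the indicator of [A]
    wherever q differs from 1/2. *)
Lemma approximable_step A (q : R * R -> R) : measurable A -> trigpoly q ->
  (forall x, 0 <= q x <= 1) ->
  (\forall x \ae (mu_x : {finite_measure set (plane R) -> \bar R}),
     (A x -> 2^-1 < q x) /\ (~ A x -> q x < 2^-1)) ->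
  approximable_set A.
Proof.
move=> mA tq q01 qA; split => //.
have tstep n : trigpoly (fun x => step_poly n (q x)).
  have := trig_add (trigpoly_cst 1) (trigpolyZ (-1) (trigpolyX (2 ^ n)
    (trig_add (trigpoly_cst 1) (trigpolyZ (-1) (trigpolyX n tq))))).
  by congr trigpoly; apply/funext => x; rewrite /step_poly !mulN1r.
apply: (@approximable_dominated _ (fun n x => step_poly n (q x)) _ (fun=> 1)) => //.
- by move=> n; case: (trigpoly_sqint (tstep n)).
- by move=> n; exact: approximable_trigpoly.
- exact: sqint_cst.
- by move=> n x; have /andP[s0 s1] := step_poly_itv n (q01 x); rewrite ger0_norm.
- by move=> x; exact: indic_bounded.
- move: qA; apply: ae_imply => x [qA qnA]; have /andP[q0 q1] := q01 x.
  have [Ax|nAx] := pselect (A x).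
    by rewrite indicE mem_set//; apply: step_poly_cvg1; rewrite qA.
  by rewrite indicE memNset//; apply: step_poly_cvg0; rewrite qnA// q0.
Qed.

Lemma ae_fst d1 d2 (T1 : measurableType d1) (T2 : measurableType d2)
    (m1 : {finite_measure set T1 -> \bar R}) (m2 : {finite_measure set T2 -> \bar R})
    (P : T1 -> Prop) :
  (\forall x \ae m1, P x) -> \forall z \ae (m1 \x m2)%E, P z.1.
Proof.
move=> [N [mN N0 PN]]; exists (N `*` setT); split.
- exact: measurableX.
- transitivity (m1 N * m2 setT)%E; first exact: product_measure1E.
  by rewrite N0 mul0e.
- by move=> [x y] /= nP; split => //; exact: PN.
Qed.

Lemma ae_snd d1 d2 (T1 : measurableType d1) (T2 : measurableType d2)
    (m1 : {finite_measure set T1 -> \bar R}) (m2 : {finite_measure set T2 -> \bar R})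
    (P : T2 -> Prop) :
  (\forall y \ae m2, P y) -> \forall z \ae (m1 \x m2)%E, P z.2.
Proof.
move=> [N [mN N0 PN]]; exists (setT `*` N); split.
- exact: measurableX.
- transitivity (m1 setT * m2 N)%E; first exact: product_measure1E.
  by rewrite N0 mule0.
- by move=> [x y] /= nP; split => //; exact: PN.
Qed.

(** Removes the points where the profile of a ray equals 1/2: the seam of the torus and the
    threshold [a]. *)
Lemma lebesgue0_ae_generic (L a : R) :
  \forall y \ae (lebesgue0 L), 0 < y < L /\ y != a.
Proof.
apply: lebesgue0_ae; exists ([set 0] `|` [set L] `|` [set a]); split.
- by apply: measurableU; [apply: measurableU|].
- apply: countable_lebesgue_measure0; apply: finite_set_countable.
  by rewrite !finite_setU.
- move=> y /=; rewrite in_itv/= => /not_implyP[/andP[y0 yL]].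
  have [->|ya] := eqVneq y a; first by right.
  move=> ny; left; have [->|y00] := eqVneq y 0; first by left.
  right; apply: contrapT => /eqP yL0; apply: ny; split => //.
  by rewrite !lt_neqAle eq_sym y00 y0 yL0 yL.
Qed.

Lemma approximable_ray (c : R * R -> R) (k : int * int) (L a : R) : 0 < L ->
  measurable_fun [set: plane R] (c : plane R -> R) ->
  (forall x, phase k x = 2 * pi / L * c x) ->
  (\forall x \ae (mu_x : {finite_measure set (plane R) -> \bar R}),
     0 < c x < L /\ c x != a) ->
  approximable_set (c @^-1` `]a, +oo[).
Proof.
move=> L0 mc kc gen.
have mA : measurable (c @^-1` `]a, +oo[ : set (plane R)).
  by rewrite -[_ @^-1` _]setTI; apply: mc => //; exact: measurable_itv.
have inA x : (c @^-1` `]a, +oo[) x = (a < c x) by rewrite /= in_itv/= andbT.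
(* For [a] outside ]0, L[ the ray has full or zero measure, and a constant profile suffices. *)
have [a0|a0] := leP a 0.
  apply: (approximable_step mA (trigpoly_cst 1)); first by move=> x; rewrite ler01 lexx.
  move: gen; apply: ae_imply => x [/andP[c0 _] _]; rewrite inA.
  by split; [lra|rewrite (le_lt_trans a0 c0)].
have [aL|aL] := leP L a.
  apply: (approximable_step mA (trigpoly_cst 0)); first by move=> x; rewrite ler01 lexx.
  move: gen; apply: ae_imply => x [/andP[_ cL] _]; rewrite inA.
  by split; [rewrite ltNge (le_trans (ltW cL) aL)|lra].
have aI : 0 < a < L by rewrite a0.
have [c0 [c1 [c2 H]]] := ray_profile aI.
pose q x := c0 + c1 * cosk k x + c2 * sink k x.
apply: (@approximable_step _ q mA).
- apply: trig_add; last exact: trig_sin.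
  by apply: trig_add; [exact: trigpoly_cst|exact: trig_cos].
- by move=> x; rewrite /q /cosk /sink kc; case: (H (c x)).
- move: gen; apply: ae_imply => x [cI ca]; rewrite inA /q /cosk /sink kc.
  have [_ /(_ cI) [H1 H2]] := H (c x); split => // /negP.
  by rewrite -leNgt => ca'; apply: H2; rewrite lt_neqAle ca.
Qed.

Lemma approximable_preimage (c : plane R -> measurableTypeR R) :
  (forall a, approximable_set (c @^-1` `]a, +oo[)) ->
  forall B : set (measurableTypeR R), measurable B -> approximable_set (c @^-1` B).
Proof.
move=> ray B; rewrite RGenOInfty.measurableE; move: B.
apply: smallest_sub.
  split.
  - by rewrite preimage_set0; exact: approximable_set0.
  - by move=> A aA; rewrite setTD preimage_setC; exact: approximable_setC.
  - by move=> F aF; rewrite preimage_bigcup; exact: approximable_bigcup.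
by move=> _ [a ->]; exact: ray.
Qed.

Lemma approximable_measurable A : measurable A -> approximable_set A.
Proof.
have fsta : forall B : set (measurableTypeR R), measurable B -> approximable_set (fst @^-1` B).
  apply: approximable_preimage => a.
  apply: (@approximable_ray _ (1, 0) (Num.sqrt 2)).
  - by rewrite sqrtr_gt0.
  - exact: measurable_fst.
  - by move=> x; rewrite /phase /wavevector /=; ring.
  - exact: (@ae_fst _ _ _ _ (lebesgue0 (Num.sqrt 2)) (lebesgue0 1) _
      (lebesgue0_ae_generic (Num.sqrt 2) a)).
have snda : forall B : set (measurableTypeR R), measurable B -> approximable_set (snd @^-1` B).
  apply: approximable_preimage => a.
  apply: (@approximable_ray _ (0, 1) 1).
  - by [].
  - exact: measurable_snd.
  - by move=> x; rewrite /phase /wavevector /=; field.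
  - exact: (@ae_snd _ _ _ _ (lebesgue0 (Num.sqrt 2)) (lebesgue0 1) _
      (lebesgue0_ae_generic 1 a)).
move: A; rewrite measurable_prod_measurableType.
apply: smallest_sub; first exact: sigma_algebra_approximable.
move=> _ [A mA [B mB <-]].
have -> : A `*` B = (fst @^-1` A) `&` (snd @^-1` B) by [].
by apply: approximable_setI; [exact: fsta|exact: snda].
Qed.

Import HBSimple HBNNSimple.

Lemma approximable_simple (h : {sfun (plane R) >-> R}) : approximable h.
Proof.
have -> : (h : plane R -> R) = (fun x => \sum_(y <- finmap.enum_fset (fset_set (range h)))
    y * \1_(h @^-1` [set y]) x).
  by apply/funext => x; rewrite fimfunE fsbig_finite.
have mh y : measurable (h @^-1` [set y]) by exact: measurable_funPTI.
elim: (finmap.enum_fset _) => [|y r IH].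
  under eq_fun do rewrite big_nil; exact/approximable_trigpoly/trigpoly_cst.
have sh z : sqint mu_x (fun x : plane R => z * \1_(h @^-1` [set z]) x).
  by apply: sqintZ; exact: sqint_indic.
under eq_fun do rewrite big_cons.
apply: approximableD => //; first by apply: sqint_sum.
apply: approximableZ; first exact: sqint_indic.
by case: (approximable_measurable (mh y)).
Qed.

(** Simple functions increase to [f], which dominates them. *)
Lemma approximable_ge0 f : sqint mu_x f -> (forall x, 0 <= f x) -> approximable f.
Proof.
move=> sf f0; have [mf _] := sf.
have mf' : measurable_fun [set: plane R] (fun x : plane R => (f x)%:E).
  exact/measurable_EFinP.
pose g := nnsfun_approx measurableT mf'.
have g0 n x : 0 <= g n x by [].
have gcvg x : g n x @[n --> \oo] --> f x.
  have := @cvg_nnsfun_approx _ _ R setT measurableT _ mf' _ x I.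
  by move=> /(_ (fun x _ => f0 x)) /fine_cvg.
have gf n x : g n x <= f x.
  have cg : cvgn (fun n => g n x) by apply/cvg_ex; exists (f x).
  rewrite -(cvg_lim (@Rhausdorff R) (gcvg x)).
  apply: nondecreasing_cvgn_le cg _ => i j ij.
  by have /lefP := nd_nnsfun_approx measurableT mf' ij; apply.
apply: (@approximable_dominated _ (fun n => g n) _ f) => //.
- by move=> n; exact: approximable_simple.
- by move=> n x; rewrite ger0_norm.
- by move=> x; rewrite ger0_norm.
- by apply: aeW.
Qed.

Lemma approximable_sqint f : sqint mu_x f -> approximable f.
Proof.
move=> sf; have [mf if2] := sf.
have -> : f = (fun x => f^\+ x + (-1) * f^\- x).
  by rewrite -{1}(funrposBneg f); apply/funext => x; rewrite mulN1r.
have absf x : f^\+ x + f^\- x = `|f x| by have /(congr1 (@^~ x)) := funrposDneg f.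
have sq (g : R * R -> R) : measurable_fun [set: plane R] (g : plane R -> R) ->
    (forall x, `|g x| <= `|f x|) -> sqint mu_x g.
  move=> mg gf; split => //; apply: rintegrable_le if2 _; first exact: measurable_funX.
  move=> x; rewrite normrX -(real_normK (num_real (f x))).
  by rewrite lerXn2r// ?nnegrE.
have sp : sqint mu_x (f^\+).
  apply: sq; first exact: measurable_funrpos.
  by move=> x; rewrite -absf ger0_norm ?funrpos_ge0// lerDl funrneg_ge0.
have sn : sqint mu_x (f^\-).
  apply: sq; first exact: measurable_funrneg.
  by move=> x; rewrite -absf ger0_norm ?funrneg_ge0// lerDr funrpos_ge0.
apply: approximableD => //; first exact: sqintZ.
  by apply: approximable_ge0 => // x; exact: funrpos_ge0.
by apply: approximableZ => //; apply: approximable_ge0 => // x; exact: funrneg_ge0.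
Qed.

(** Take a polynomial within squared distance e of [f]. For large boxes it is orthogonal to the
    residual, and best approximation bounds the missing energy by e. *)
Lemma parseval f e : sqint mu_x f -> 0 < e -> exists n, forall m, (n <= m)%N ->
  \int[mu_x]_x (f x ^+ 2) <= fourier_energy (box m) f + e.
Proof.
move=> sf e0; have [p [tp fpe]] := approximable_sqint sf e0.
have [n np] := residual_trigpoly tp; exists n => m nm.
rewrite -lerBlDl; apply: le_trans (residual_best sf (trigpoly_sqint tp) (sym_box m) _) fpe.
exact: np.
Qed.

End density_of_trigonometric_polynomials.

(** * Smooth functions on the line that vanish on the negative half-line *)

Section flat_functions.
Variable R : realType.
Implicit Types (c y z : R) (Q : {poly R}).

Lemma poly_expR_bounded c Q : 0 < c ->
  exists K, forall z, 0 <= z -> `|Q.[z]| * expR (- (c * z)) <= K.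
Proof.
move=> c0; elim/poly_ind: Q => [|Q r _].
  by exists 0 => z z0; rewrite horner0 normr0 mul0r.
have mono n : exists K, forall z, 0 <= z -> z ^+ n * expR (- (c * z)) <= K.
  (* The constant comes from z^n <= 1 + z^(n+1) and exp(c z) >= 1 + (c z)^(n+1) / (n+1)!. *)
  exists (n.+1`!%:R / c ^+ n.+1 + 1) => z z0.
  have e0 : 0 < expR (c * z) by exact: expR_gt0.
  rewrite expRN -ler_pdivlMr ?invr_gt0// invrK.
  have cz : 0 <= c * z by rewrite mulr_ge0// ltW.
  have h1 := expR_ge1Dxn n cz.
  have f0 : 0 < n.+1`!%:R :> R by rewrite ltr0n fact_gt0.
  have cn : 0 < c ^+ n.+1 by rewrite exprn_gt0.
  have z1 : z ^+ n <= 1 + z ^+ n.+1.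
    have [zl|zg] := leP z 1.
      by rewrite (le_trans (exprn_ile1 _ z0 zl))// lerDl exprn_ge0.
    by rewrite ler_wpDl// exprS ler_peMl ?exprn_ge0// ltW.
  apply: (le_trans z1); rewrite mulrDl mul1r addrC; apply: lerD; last first.
    by apply: le_trans h1; rewrite lerDl divr_ge0 ?exprn_ge0// ltW.
  rewrite -ler_pdivrMl ?divr_gt0// invf_div; apply: le_trans h1.
  by rewrite exprMn mulrAC ler_wpDl// mulrC mulrA.
pose P := Q * 'X + r%:P; rewrite -/P.
have [KK hK] : exists K : nat -> R, forall n z, 0 <= z -> z ^+ n * expR (- (c * z)) <= K n.
  by have [f hf] := choice mono; exists f.
exists (\sum_(i < size P) `|P`_i| * KK i) => z z0.
rewrite horner_coef; apply: (@le_trans _ _ (\sum_(i < size P)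
    (`|P`_i| * z ^+ i) * expR (- (c * z)))).
  rewrite -mulr_suml ler_wpM2r ?expR_ge0//.
  apply: le_trans (ler_norm_sum _ _ _) _; apply: ler_sum => i _.
  by rewrite normrM (ger0_norm (exprn_ge0 _ z0)).
by apply: ler_sum => i _; rewrite -mulrA ler_wpM2l// hK.
Qed.

(* [flat c 1] is smooth, vanishes for y <= 0, and tends to the positive part of y
   as c -> 0; the class of all [flat c Q] is closed under differentiation. *)
Definition flat c Q y : R :=
  if 0 < y then y * (Q.[y^-1] * expR (- (c * y^-1))) else 0.

(** Found by differentiating y Q(1/y) exp(-c/y) and factoring the result again as y times a
    polynomial in 1/y times the same exponential. *)
Definition flat_deriv c Q := 'X * Q - 'X^2 * Q^`() + c *: ('X^2 * Q).

Lemma flat_le0 c Q y : y <= 0 -> flat c Q y = 0.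
Proof. by rewrite /flat leNgt => /negbTE ->. Qed.

(** With y = y^2 / y, the factor 1/y joins the polynomial and the exponential bound applies. The
    quadratic decay is what gives the derivative at 0. *)
Lemma flat_quadratic c Q : 0 < c -> exists2 K, 0 <= K & forall y, `|flat c Q y| <= K * y ^+ 2.
Proof.
move=> c0; have [K hK] := @poly_expR_bounded c ('X * Q) c0.
exists K.
  by apply: le_trans (hK 0 (lexx _)); rewrite mulr_ge0// expR_ge0.
move=> y; rewrite /flat; case: ltP => [y0|_]; last first.
  rewrite normr0 mulr_ge0 ?sqr_ge0//.
  by apply: le_trans (hK 0 (lexx _)); rewrite mulr_ge0// expR_ge0.
have y1 : 0 <= y^-1 by rewrite invr_ge0 ltW.
have := hK _ y1; rewrite hornerM hornerX !normrM (ger0_norm y1) (gtr0_norm y0).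
rewrite [`|expR _|]ger0_norm ?expR_ge0// => h.
rewrite (_ : y * _ = y^-1 * `|Q.[y^-1]| * expR (- (c * y^-1)) * y ^+ 2); last first.
  by field; rewrite gt_eqF.
by rewrite ler_wpM2r// sqr_ge0.
Qed.

Lemma is_derive_flat c Q y : 0 < c ->
  is_derive y (1 : R) (flat c Q) (flat c (flat_deriv c Q) y).
Proof.
move=> c0; have [y0|y0|y0] := ltrgtP y 0.
- rewrite flat_le0 ?ltW//; apply: (@near_eq_is_derive _ _ _ (cst 0)).
    by near=> x; rewrite flat_le0// ltW//; near: x; exact: lt_nbhsl.
- apply: (@near_eq_is_derive _ _ _
    (fun y => y * (Q.[y^-1] * expR (- (c * y^-1))))).
    by near=> x; rewrite /flat ifT//; near: x; exact: lt_nbhsr.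
  have dV : is_derive y (1 : R) (fun x : R => x^-1) (- y ^- 2).
    have yn0 : (@id R) y != 0 by rewrite gt_eqF.
    have := is_deriveV yn0 (is_derive_id y (1 : R)).
    by rewrite /GRing.scale /= mulr1.
  have dQ : is_derive y (1 : R) (fun x : R => Q.[x^-1]) (Q^`().[y^-1] * (- y ^- 2)).
    exact: (@is_derive1_comp _ (horner Q) (fun x : R => x^-1)).
  have dN : is_derive y (1 : R) (fun x : R => - (c * x^-1)) (- (c * (- y ^- 2))).
    exact: is_deriveN.
  have dE : is_derive y (1 : R) (fun x : R => expR (- (c * x^-1)))
      (expR (- (c * y^-1)) * (- (c * (- y ^- 2)))).
    exact: (@is_derive1_comp _ expR (fun x : R => - (c * x^-1))).
  apply: is_derive_eq.
  rewrite /flat y0 /flat_deriv.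
  rewrite !hornerD hornerN hornerZ !hornerM hornerX -![_ *: _]/(_ * _).
  by field; rewrite gt_eqF.
(* At 0 the difference quotient has modulus at most K |h|. *)
- have [K K0 hK] := flat_quadratic Q c0.
  have f0 P : flat c P 0 = 0 by rewrite flat_le0.
  have cv : h^-1 *: ((flat c Q \o shift (0 : R)) (h *: (1 : R)) - flat c Q 0)
      @[h --> 0^'] --> (0 : R).
    apply/cvgrPdist_le => e e0; near=> h.
    have h0 : h != 0 by near: h; exact: nbhs_dnbhs_neq.
    rewrite f0 sub0r normrN subr0 /GRing.scale /= mulr1 addr0 normrM normfV.
    rewrite ler_pdivrMl ?normr_gt0//; apply: (le_trans (hK h)).
    rewrite -(real_normK (num_real h)) expr2 mulrCA ler_wpM2l//.
    have hK1 : `|h| <= e / (K + 1).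
      by near: h; apply: dnbhs0_le; rewrite divr_gt0// ltr_wpDl.
    rewrite (le_trans (ler_wpM2l K0 hK1))// mulrCA ger_pMr//.
    by rewrite ler_pdivrMr ?ltr_wpDl// mul1r lerDl.
  rewrite y0; split; first by apply/cvg_ex; exists 0.
  by rewrite f0; apply/cvg_lim.
Unshelve. all: by end_near. Qed.

Lemma continuous_flat c Q : 0 < c -> continuous (flat c Q).
Proof.
move=> c0 y; apply: differentiable_continuous; apply/derivable1_diffP.
by have [] := is_derive_flat Q y c0.
Qed.

Lemma flat1E c y : 0 < y -> flat c 1 y = y * expR (- (c * y^-1)).
Proof. by move=> y0; rewrite /flat y0 hornerC mul1r. Qed.

(** The bound is uniform in [c], as dominated convergence for c tending to 0 requires. *)
Lemma flat1_itv c y : 0 <= c -> 0 <= flat c 1 y <= `|y|.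
Proof.
move=> c0; have [y0|y0] := leP y 0; first by rewrite flat_le0// lexx normr_ge0.
rewrite flat1E// mulr_ge0 ?expR_ge0 ?(ltW y0)//= gtr0_norm// ger_pMr// expR_le1.
by rewrite oppr_le0 mulr_ge0// invr_ge0 ltW.
Qed.

Lemma flat_deriv1E c y : 0 < y ->
  flat c (flat_deriv c 1) y = (1 + c * y^-1) * expR (- (c * y^-1)).
Proof.
move=> y0; rewrite /flat y0 /flat_deriv derivC mulr0 subr0 !mulr1.
by rewrite hornerD hornerZ hornerM hornerX; field; rewrite gt_eqF.
Qed.

(** Again uniform in [c], from 1 + x <= exp x at x = c / y. *)
Lemma flat_deriv1_itv c y : 0 <= c -> 0 <= flat c (flat_deriv c 1) y <= 1.
Proof.
move=> c0; have [y0|y0] := leP y 0; first by rewrite flat_le0// lexx ler01.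
rewrite flat_deriv1E//.
have z0 : 0 <= c * y^-1 by rewrite mulr_ge0// invr_ge0 ltW.
apply/andP; split; first by rewrite mulr_ge0 ?expR_ge0//; lra.
by rewrite expRN ler_pdivrMr ?expR_gt0// mul1r expR_ge1Dx.
Qed.

Lemma expR_vanishing_cvg (a : R) : expR (- (n.+1%:R^-1 * a)) @[n --> \oo] --> (1 : R).
Proof.
rewrite -[X in _ --> X]expR0; apply: continuous_cvg; first exact: continuous_expR.
rewrite -[X in _ --> X]oppr0; apply: cvgN.
rewrite -[X in _ --> X](mul0r a); apply: cvgM; last exact: cvg_cst.
exact: cvg_harmonic.
Qed.

Lemma flat1_cvg y : flat n.+1%:R^-1 1 y @[n --> \oo] --> Num.max 0 y.
Proof.
have [y0|y0] := leP y 0.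
  by under eq_fun do rewrite flat_le0//; exact: cvg_cst.
have -> : (fun n => flat n.+1%:R^-1 1 y) =
    (fun n => y * expR (- (n.+1%:R^-1 * y^-1))).
  by apply/funext => n; rewrite flat1E.
by rewrite -[X in _ --> X]mulr1; apply: cvgM; [exact: cvg_cst|exact: expR_vanishing_cvg].
Qed.

Lemma flat_deriv1_cvg y :
  flat n.+1%:R^-1 (flat_deriv n.+1%:R^-1 1) y @[n --> \oo] --> ((0 < y)%R%:R : R).
Proof.
have [y0|y0] := leP y 0.
  by under eq_fun do rewrite flat_le0//; exact: cvg_cst.
have -> : (fun n => flat n.+1%:R^-1 (flat_deriv n.+1%:R^-1 1) y) =
    (fun n => (1 + n.+1%:R^-1 * y^-1) * expR (- (n.+1%:R^-1 * y^-1))).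
  by apply/funext => n; rewrite flat_deriv1E.
rewrite -[X in _ --> X]mulr1; apply: cvgM; last exact: expR_vanishing_cvg.
rewrite -[X in _ --> X]addr0; apply: cvgD; first exact: cvg_cst.
rewrite -[X in _ --> X](mul0r y^-1); apply: cvgM; last exact: cvg_cst.
exact: cvg_harmonic.
Qed.

End flat_functions.

(** * Test functions: a flat cutoff in time multiplied by a mode in space *)

Section test_functions.
Variable R : realType.
Implicit Types (k : int * int) (Q : {poly R}) (z v : R * (R * R)).

(** The cutoff vanishes for t >= b. Carrying [Q] and both amplitudes keeps the shape under
    derivatives: those in time change [Q], those in space turn (al, be) into a multiple of (be, -
    al). *)
Definition modulated (c b : R) k Q (al be : R) z : R :=
  flat c Q (b - z.1) * (al * cosk k z.2 + be * sink k z.2).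

Lemma is_derive_modulated (c b : R) k Q (al be : R) z v : 0 < c ->
  is_derive z v (modulated c b k Q al be)
    (modulated c b k (flat_deriv c Q) (- v.1 * al) (- v.1 * be) z +
     modulated c b k Q (phase k v.2 * be) (- phase k v.2 * al) z).
Proof.
move=> c0; set d := (X in is_derive _ _ _ X).
have line h : phase k (h *: v + z).2 = h * phase k v.2 + phase k z.2.
  by rewrite /phase /= -![_ *: _]/(_ * _); ring.
(* A directional derivative is an ordinary derivative along the line through z. *)
suff H : is_derive (0 : R) (1 : R) (fun h : R => modulated c b k Q al be (h *: v + z)) d.
  have [H1 H2] := H; split; first exact: (derivable1P _ _ _).2 H1.
  rewrite -H2 /derive; set g1 := (fun h : R => h^-1 *: _); set g2 := (fun h : R => h^-1 *: _).
  suff -> : g1 = g2 by [].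
  apply/funext => h; rewrite /g1 /g2 /=.
  by rewrite addr0 scale0r add0r [_%:A]mulr1.
pose ft (h : R) := b - (h * v.1 + z.1).
pose fp (h : R) := h * phase k v.2 + phase k z.2.
have -> : (fun h : R => modulated c b k Q al be (h *: v + z)) =
  (fun h => flat c Q (ft h) * (al * cos (fp h) + be * sin (fp h))).
  by apply/funext => h; rewrite /modulated /cosk /sink line.
have dft : is_derive (0 : R) (1 : R) ft (- v.1).
  by apply: is_derive_eq; rewrite -![_ *: _]/(_ * _); ring.
have dfp : is_derive (0 : R) (1 : R) fp (phase k v.2).
  by apply: is_derive_eq; rewrite -![_ *: _]/(_ * _); ring.
have dfl : is_derive (0 : R) (1 : R) (fun h => flat c Q (ft h))
    (flat c (flat_deriv c Q) (ft 0) * (- v.1)).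
  by apply: (@is_derive1_comp _ (flat c Q)); exact: is_derive_flat.
have dc : is_derive (0 : R) (1 : R) (fun h => cos (fp h)) (- sin (fp 0) * phase k v.2).
  exact: is_derive1_comp.
have ds : is_derive (0 : R) (1 : R) (fun h => sin (fp h)) (cos (fp 0) * phase k v.2).
  exact: is_derive1_comp.
apply: is_derive_eq.
rewrite /d /modulated /cosk /sink /ft /fp !mul0r !add0r -![_ *: _]/(_ * _). ring.
Qed.

(** A directional derivative of one term is a sum of two terms, so [Ck] at every order is proved for
    sums. *)
Inductive modulated_sum (c b : R) k : (R * (R * R) -> R) -> Prop :=
| modulated_sum1 Q al be : modulated_sum c b k (modulated c b k Q al be)
| modulated_sumD f g : modulated_sum c b k f -> modulated_sum c b k g ->
    modulated_sum c b k (fun z => f z + g z).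

Lemma derivable_modulated_sum (c b : R) k f : 0 < c -> modulated_sum c b k f ->
  (forall z v, derivable f z v) /\ forall v, modulated_sum c b k ('D_v f).
Proof.
move=> c0; elim=> [Q al be|{}f g _ [df Df] _ [dg Dg]].
  split=> [z v|v]; first by have [] := is_derive_modulated b k Q al be z v c0.
  have -> : 'D_v (modulated c b k Q al be) = fun z =>
      modulated c b k (flat_deriv c Q) (- v.1 * al) (- v.1 * be) z +
      modulated c b k Q (phase k v.2 * be) (- phase k v.2 * al) z.
    by apply/funext => z; have [_ ->] := is_derive_modulated b k Q al be z v c0.
  by apply: modulated_sumD; exact: modulated_sum1.
split=> [z v|v]; first exact: derivableD.
have -> : 'D_v (fun z => f z + g z) = fun z => 'D_v f z + 'D_v g z.
  by apply/funext => z; rewrite -deriveD.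
exact: modulated_sumD.
Qed.

Lemma continuous_modulated_sum (c b : R) k f : 0 < c -> modulated_sum c b k f ->
  continuous f.
Proof.
move=> c0; elim=> [Q al be|{}f g _ cf _ cg] z; last by apply: cvgD; [exact: cf|exact: cg].
have cph : continuous (phase k : R * R -> R).
  move=> x; apply: cvgD; apply: cvgM; try exact: cvg_cst.
    exact: cvg_fst.
  exact: cvg_snd.
have cph2 : {for z, continuous (fun z : R * (R * R) => phase k z.2)}.
  by apply: (@continuous_comp _ _ _ (fun z : R * (R * R) => z.2) (phase k));
    [exact: cvg_snd|exact: cph].
apply: cvgM.
  apply: (@continuous_comp _ _ _ (fun z : R * (R * R) => b - z.1)).
    by apply: cvgB; [exact: cvg_cst|exact: cvg_fst].
  exact: continuous_flat.
apply: cvgD; apply: cvgM; try exact: cvg_cst.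
  exact: (@continuous_comp _ _ _ _ (@cos R) _ cph2 (@continuous_cos R _)).
exact: (@continuous_comp _ _ _ _ (@sin R) _ cph2 (@continuous_sin R _)).
Qed.

Lemma Ck_modulated_sum (c b : R) k n f : 0 < c -> modulated_sum c b k f -> Ck n f.
Proof.
move=> c0; elim: n f => [|n IH] f mf.
  by split => //; exact: continuous_modulated_sum mf.
split; first exact: continuous_modulated_sum mf.
have [df Df] := derivable_modulated_sum c0 mf.
by split => // v; exact: IH.
Qed.

Lemma test_initial_modulated (c b : R) k Q (al be : R) : 0 < c -> b < 1 ->
  test_initial (modulated c b k Q al be).
Proof.
move=> c0 b1; split; last first.
  by exists b => // t x bt; rewrite /modulated flat_le0 ?mul0r// subr_le0.
split; last by move=> n; apply: (@Ck_modulated_sum c b k) => //; exact: modulated_sum1.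
move=> t x1 x2; rewrite /modulated /cosk /sink /=.
have -> : phase k (x1 + Num.sqrt 2, x2) = phase k (x1, x2) + 2 * pi * k.1%:~R.
  by rewrite /phase /wavevector /=; field; exact: sqrt2_neq0.
have -> : phase k (x1, x2 + 1) = phase k (x1, x2) + 2 * pi * k.2%:~R.
  by rewrite /phase /wavevector /=; field; exact: sqrt2_neq0.
by rewrite !cosD2piz !sinD2piz.
Qed.

Lemma derive_modulated (c b : R) k Q (al be : R) v : 0 < c ->
  'D_v (modulated c b k Q al be) = fun z =>
    modulated c b k (flat_deriv c Q) (- v.1 * al) (- v.1 * be) z +
    modulated c b k Q (phase k v.2 * be) (- phase k v.2 * al) z.
Proof.
by move=> c0; apply/funext => z; have [_ ->] := is_derive_modulated b k Q al be z v c0.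
Qed.

Lemma dt_modulated (c b : R) k Q (al be : R) : 0 < c ->
  dt (modulated c b k Q al be) = modulated c b k (flat_deriv c Q) (- al) (- be).
Proof.
move=> c0; rewrite /dt derive_modulated//; apply/funext => z.
by rewrite /modulated /phase /=; ring.
Qed.

Lemma dx1_modulated (c b : R) k Q (al be : R) : 0 < c ->
  dx1 (modulated c b k Q al be) =
  modulated c b k Q ((wavevector R k).1 * be) (- (wavevector R k).1 * al).
Proof.
move=> c0; rewrite /dx1 derive_modulated//; apply/funext => z.
by rewrite /modulated /phase /=; ring.
Qed.

Lemma dx2_modulated (c b : R) k Q (al be : R) : 0 < c ->
  dx2 (modulated c b k Q al be) =
  modulated c b k Q ((wavevector R k).2 * be) (- (wavevector R k).2 * al).
Proof.
move=> c0; rewrite /dx2 derive_modulated//; apply/funext => z.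
by rewrite /modulated /phase /=; ring.
Qed.

Lemma laplacian_modulated (c b : R) k Q (al be : R) : 0 < c ->
  laplacian (modulated c b k Q al be) = fun z =>
  - ((wavevector R k).1 ^+ 2 + (wavevector R k).2 ^+ 2) * modulated c b k Q al be z.
Proof.
move=> c0; rewrite /laplacian !dx1_modulated// !dx2_modulated//; apply/funext => z.
by rewrite /modulated; ring.
Qed.

End test_functions.

(** * Mixed norms and square integrability in space-time *)

Section norms.
Variable R : realType.
Local Notation mu_t := (@time_measure R).
Local Notation mu_x := (@torus_measure R).
Local Notation mu_tx := (@spacetime_measure R).
Implicit Types (f g : R * R -> R) (h : R * (R * R) -> R).

Lemma sqr_L2norm f : (L2norm f `^ 2 = \int[mu_x]_x (f x ^+ 2)%:E)%E.
Proof.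
rewrite /L2norm poweR_Lnorm//; apply: eq_integral => x _ /=.
by rewrite powR_mulrn// real_normK// num_real.
Qed.

Lemma sqint_L2 f : L2 f -> sqint mu_x f.
Proof.
move=> fL; have mf : measurable_fun [set: plane R] (f : plane R -> R).
  by have := sub_Lfun_mfun fL; rewrite inE.
have fy : finite_norm mu_x 2%:E f by have := sub_Lfun_finLfun fL; rewrite inE.
split => //.
apply/integrableP; split; first by apply/measurable_EFinP; exact: measurable_funX.
under eq_integral do rewrite /= ger0_norm ?sqr_ge0//.
by rewrite -sqr_L2norm poweR_lty.
Qed.

Lemma sqr_L2norm_sqint f : sqint mu_x f ->
  (L2norm f `^ 2 = (\int[mu_x]_x (f x ^+ 2))%:E)%E.
Proof.
by move=> [mf if2]; rewrite sqr_L2norm /Rintegral fineK//; exact: integrable_fin_num.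
Qed.

Lemma sqint_spacetime h : measurable_fun [set: spacetime R] (h : spacetime R -> R) ->
  (\int[mu_t]_t (\int[mu_x]_x (h (t, x) ^+ 2)%:E) < +oo)%E -> sqint mu_tx h.
Proof.
move=> mh hy; split=> //; apply/integrableP; split.
  by apply/measurable_EFinP; exact: measurable_funX.
under eq_integral do rewrite /= ger0_norm ?sqr_ge0//.
rewrite (@fubini_tonelli1 _ _ _ _ _ mu_t mu_x)//.
  by apply/measurable_EFinP; exact: measurable_funX.
by move=> z; rewrite lee_fin sqr_ge0.
Qed.

Lemma sqint_spacetime_fubini h : sqint mu_tx h ->
  (\int[mu_t]_t (\int[mu_x]_x (h (t, x) ^+ 2)%:E) < +oo)%E.
Proof.
move=> [mh /integrableP[_]].
under eq_integral do rewrite /= ger0_norm ?sqr_ge0//.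
rewrite (@fubini_tonelli1 _ _ _ _ _ mu_t mu_x)//.
  by apply/measurable_EFinP; exact: measurable_funX.
by move=> z; rewrite lee_fin sqr_ge0.
Qed.

Lemma sqint_slice h : sqint mu_tx h -> \forall t \ae mu_t, sqint mu_x (slice h t).
Proof.
move=> [mh ih]; have := ae_integrable1 (m1 := mu_t) (m2 := mu_x) ih.
apply: ae_imply => t it; split; last exact: it.
by apply: (measurableT_comp mh); exact: pair1_measurable.
Qed.

Lemma time_measureT : mu_t [set: R] = 1%:E.
Proof. exact: (lebesgue0T ler01). Qed.

Lemma time_measure_gt0 : (0 < mu_t [set: R])%E.
Proof. by rewrite time_measureT lte_fin ltr01. Qed.

(** Time has total mass 1, so the squared essential supremum bounds the space-time integral. *)
Lemma sqint_LinfL2 h : LinfL2 h -> sqint mu_tx h.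
Proof.
move=> [mh]; rewrite /LinfL2_norm unlock time_measure_gt0 => hy.
apply: sqint_spacetime => //.
set M := ess_sup _ _ in hy.
have hM := ess_sup_ge mu_t (abse \o (fun t => L2norm (slice h t))).
have mF : measurable_fun setT (fun t => \int[mu_x]_x (h (t, x) ^+ 2)%:E)%E.
  apply: (@measurable_fun_fubini_tonelli_F _ _ _ _ _ mu_x (fun z => (h z ^+ 2)%:E)).
    by apply/measurable_EFinP; exact: measurable_funX.
  by move=> z; rewrite lee_fin sqr_ge0.
apply: (@le_lt_trans _ _ (\int[mu_t]_t (M `^ 2))%E).
  apply: ae_ge0_le_integral => //.
  - by move=> t _; apply: integral_ge0 => x _; rewrite lee_fin sqr_ge0.
  - by move=> t _; exact: poweR_ge0.
  - move: hM; apply: ae_imply => t /= hM _.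
    rewrite -(sqr_L2norm (slice h t)).
    have L0 : (0 <= L2norm (slice h t))%E by exact: Lnorm_ge0.
    rewrite gee0_abs// in hM.
    by apply: gt0_ler_poweR => //; rewrite in_itv/= ?L0 ?(le_trans L0 hM) ?leey.
rewrite integral_cst// lte_mul_pinfty//.
- exact: poweR_ge0.
- by rewrite ge0_fin_numE ?poweR_ge0// poweR_lty.
- by apply: (@le_lt_trans _ _ 1%:E); [rewrite -time_measureT|exact: ltry].
Qed.

(** Makes square-integrable functions admissible in [weak_star_cvg]. The norm of a slice is the
    square root of F t, hence at most 1 + F t, and time has finite mass. *)
Lemma L1L2_sqint h : sqint mu_tx h -> L1L2 h.
Proof.
move=> sh; have [mh _] := sh; split => //.
have := sqint_spacetime_fubini sh; set F := (X in (\int[mu_t]_t X t < _)%E) => Fy.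
have F0 t : (0 <= F t)%E by apply: integral_ge0 => x _; rewrite lee_fin sqr_ge0.
have mF : measurable_fun setT F.
  apply: (@measurable_fun_fubini_tonelli_F _ _ _ _ _ mu_x (fun z => (h z ^+ 2)%:E)).
    by apply/measurable_EFinP; exact: measurable_funX.
  by move=> z; rewrite lee_fin sqr_ge0.
have L0 t : (0 <= L2norm (slice h t))%E by exact: Lnorm_ge0.
have LE t : L2norm (slice h t) = (F t `^ 2^-1)%E.
  by rewrite -[F t](sqr_L2norm (slice h t)) -poweRrM mulfV// poweRe1.
rewrite /L1L2_norm Lnorm1.
apply: (@le_lt_trans _ _ (\int[mu_t]_t (1 + F t))%E).
  apply: ge0_le_integral => //.
  - apply: measurableT_comp => //; under eq_fun do rewrite LE.
    exact: (measurableT_comp (measurable_poweR _) mF).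
  - exact: emeasurable_funD.
  - move=> t _; rewrite gee0_abs// LE; case: (F t) (F0 t) => [r||]//=.
      rewrite lee_fin => r0; rewrite lee_fin powR12_sqrt//.
      have := sqr_sqrtr r0; have := sqrtr_ge0 r; nra.
    by move=> _; rewrite leey.
rewrite ge0_integralD//.
rewrite integral_cst// mul1e.
by rewrite lte_add_pinfty//; apply: (@le_lt_trans _ _ 1%:E);
  [rewrite -time_measureT|exact: ltry].
Qed.

Lemma Linf_fieldP (u : R * (R * R) -> R * R) : Linf_field u ->
  [/\ measurable_fun [set: spacetime R] (fun z : spacetime R => (u z).1),
      measurable_fun [set: spacetime R] (fun z : spacetime R => (u z).2) &
      exists M, \forall z \ae mu_tx, `|(u z).1| <= M /\ `|(u z).2| <= M].
Proof.
have bnd (v : R * (R * R) -> R) : v \in Lfun mu_tx +oo%E ->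
    measurable_fun [set: spacetime R] (v : spacetime R -> R) /\
    exists M, \forall z \ae mu_tx, `|v z| <= M.
  move=> vL; split; first by have := sub_Lfun_mfun vL; rewrite inE.
  have : finite_norm mu_tx +oo%E v by have := sub_Lfun_finLfun vL; rewrite inE.
  rewrite /finite_norm unlock; case: ifPn => [_|mu0 _].
    by move=> /ess_supr_bounded[M vM]; exists M.
  (* For a measure of total mass 0 the norm is 0 by convention, and any bound holds almost
     everywhere. *)
  exists 0; exists setT; split => //.
  by apply/eqP; rewrite eq_le measure_ge0 andbT leNgt.
move=> [/bnd[m1 [M1 b1]] /bnd[m2 [M2 b2]]]; split => //.
exists (Num.max M1 M2); move: (ae_and b1 b2); apply: ae_imply => z [h1 h2].
by rewrite !le_max h1 h2 orbT.
Qed.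

End norms.

(** * The weak formulation in the limit of vanishing diffusivity *)

Section transport_limit.
Variable R : realType.
Local Notation mu_t := (@time_measure R).
Local Notation mu_x := (@torus_measure R).
Local Notation mu_tx := (@spacetime_measure R).
Implicit Types (h : R * (R * R) -> R) (k : int * int).

Lemma ae_time_itv : \forall t \ae mu_t, 0 <= t <= 1.
Proof. by apply: lebesgue0_ae; apply: aeW => t; rewrite in_itv. Qed.

Lemma ae_spacetime_itv : \forall z \ae mu_tx, 0 <= z.1 <= 1.
Proof. exact: (@ae_fst _ _ _ _ _ mu_t mu_x _ ae_time_itv). Qed.

Definition trig_mode k (al be : R) (x : R * R) : R := al * cosk k x + be * sink k x.

Lemma trig_mode_bounded k al be x : `|trig_mode k al be x| <= `|al| + `|be|.
Proof.
rewrite (le_trans (ler_normD _ _))// !normrM lerD// ler_piMr//.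
  exact: cos_max.
exact: sin_max.
Qed.

Lemma measurable_trig_mode k al be :
  measurable_fun [set: plane R] (trig_mode k al be : plane R -> R).
Proof.
by apply: measurable_funD; apply: measurable_funM => //;
  [exact: measurable_cosk|exact: measurable_sink].
Qed.

Lemma sqint_trig_mode k al be : sqint mu_x (trig_mode k al be).
Proof.
apply: (@sqint_bounded _ _ _ _ _ (`|al| + `|be|)).
  exact: measurable_trig_mode.
exact: trig_mode_bounded.
Qed.

Lemma measurable_time_comp (f : R -> R) : measurable_fun setT f ->
  measurable_fun [set: spacetime R] (fun z : spacetime R => f z.1).
Proof. by move=> mf; exact: (measurableT_comp mf measurable_fst). Qed.

Lemma measurable_space_comp (f : R * R -> R) :
  measurable_fun [set: plane R] (f : plane R -> R) ->
  measurable_fun [set: spacetime R] (fun z : spacetime R => f z.2).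
Proof. by move=> mf; exact: (measurableT_comp mf measurable_snd). Qed.

Lemma measurable_flat (c : R) Q : 0 < c -> measurable_fun setT (flat c Q).
Proof. by move=> c0; apply: continuous_measurable_fun; exact: continuous_flat. Qed.

Lemma measurable_modulated (c b : R) k Q al be : 0 < c ->
  measurable_fun [set: spacetime R] (modulated c b k Q al be : spacetime R -> R).
Proof.
move=> c0; apply: measurable_funM.
  apply: (@measurable_time_comp (fun t => flat c Q (b - t))).
  apply: (measurableT_comp (measurable_flat Q c0)).
  by apply: measurable_funB.
exact: (measurable_space_comp (measurable_trig_mode k al be)).
Qed.

Lemma modulated_bounded (c b : R) k Q al be : 0 < c ->
  exists M, \forall z \ae mu_tx, `|modulated c b k Q al be z| <= M.
Proof.
move=> c0; have [K K0 hK] := flat_quadratic Q c0.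
exists (K * (`|b| + 1) ^+ 2 * (`|al| + `|be|)).
move: ae_spacetime_itv; apply: ae_imply => z /andP[z0 z1].
rewrite normrM; apply: ler_pM => //; last exact: trig_mode_bounded.
apply: (le_trans (hK _)); rewrite ler_wpM2l// -(real_normK (num_real (b - _))).
rewrite lerXn2r// ?nnegrE ?addr_ge0//.
by rewrite (le_trans (ler_normB _ _))// lerD2l ger0_norm.
Qed.

Lemma sqint_modulated (c b : R) k Q al be : 0 < c ->
  sqint mu_tx (modulated c b k Q al be).
Proof.
move=> c0; have [M hM] := modulated_bounded b k Q al be c0.
apply: (@sqint_ae_bounded _ _ _ _ _ M) => //; exact: measurable_modulated.
Qed.

Lemma sqint_ae_mul (f g : R * (R * R) -> R) :
  measurable_fun [set: spacetime R] (f : spacetime R -> R) ->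
  measurable_fun [set: spacetime R] (g : spacetime R -> R) ->
  (exists M, \forall z \ae mu_tx, `|f z| <= M) ->
  (exists M, \forall z \ae mu_tx, `|g z| <= M) ->
  sqint mu_tx (fun z => f z * g z).
Proof.
move=> mf mg [M fM] [N gN]; apply: (@sqint_ae_bounded _ _ _ _ _ (M * N)).
  exact: measurable_funM.
by move: (ae_and fM gN); apply: ae_imply => z [fz gz]; rewrite normrM ler_pM.
Qed.

Section limit_equation.
Variables (u : R * (R * R) -> R * R) (theta0 : R * R -> R).
Hypothesis u_Linf : Linf_field u.

Lemma sqint_dot_grad (c b : R) k Q al be : 0 < c ->
  sqint mu_tx (dot_grad u (modulated c b k Q al be)).
Proof.
move=> c0; have [mu1 mu2 [M uM]] := Linf_fieldP u_Linf.
rewrite /dot_grad dx1_modulated// dx2_modulated//; apply: sqintD.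
- apply: sqint_ae_mul => //; [exact: measurable_modulated| |exact: modulated_bounded].
  by exists M; move: uM; apply: ae_imply => z [].
- apply: sqint_ae_mul => //; [exact: measurable_modulated| |exact: modulated_bounded].
  by exists M; move: uM; apply: ae_imply => z [].
Qed.

(** The transport term is linear in the solution, with the fixed square-integrable factor u . grad
    phi, so weak-* convergence suffices. The diffusive term is kappa_j times a convergent
    sequence. *)
Lemma limit_equation (thetaj : nat -> R * (R * R) -> R) (theta : R * (R * R) -> R)
    (kappa_ : nat -> R) (c b : R) k al be :
  (forall j, solves u (kappa_ j) theta0 (thetaj j)) ->
  kappa_ j @[j --> \oo] --> (0 : R) -> weak_star_cvg thetaj theta ->
  0 < c -> b < 1 -> let phi := modulated c b k 1 al be in
  \int[mu_tx]_z (theta z * (dt phi z + dot_grad u phi z)) +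
    \int[mu_x]_x (theta0 x * phi (0, x)) = 0.
Proof.
move=> sol kcvg wcvg c0 b1 phi.
have tphi : test_initial phi by exact: test_initial_modulated.
set c0' := (\int[mu_x]_x _).
have sdt : sqint mu_tx (dt phi) by rewrite dt_modulated//; exact: sqint_modulated.
have sdg : sqint mu_tx (dot_grad u phi) by exact: sqint_dot_grad.
have slap : sqint mu_tx (laplacian phi).
  by rewrite laplacian_modulated//; apply: sqintZ; exact: sqint_modulated.
have sg := sqintD sdt sdg.
have cvg1 := wcvg _ (L1L2_sqint sg).
have cvg3 : (\int[mu_tx]_z (thetaj n z * (dt phi z + dot_grad u phi z)) +
    kappa_ n * \int[mu_tx]_z (thetaj n z * laplacian phi z) + c0') @[n --> \oo] -->
    \int[mu_tx]_z (theta z * (dt phi z + dot_grad u phi z)) +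
    0 * \int[mu_tx]_z (theta z * laplacian phi z) + c0'.
  apply: cvgD; last exact: cvg_cst.
  by apply: cvgD => //; apply: cvgM => //; exact: wcvg (L1L2_sqint slap).
have E j : \int[mu_tx]_z (thetaj j z * (dt phi z + dot_grad u phi z)) +
    kappa_ j * \int[mu_tx]_z (thetaj j z * laplacian phi z) + c0' = 0.
  have [/sqint_LinfL2 sth /(_ _ tphi) <-] := sol j; congr (_ + _).
  rewrite -RintegralZl//; last exact: sqint_mul.
  have i1 := sqint_mul sth sg; have i2 := rintegrableZ (kappa_ j) (sqint_mul sth slap).
  by rewrite -(RintegralD measurableT i1 i2); apply: eq_Rintegral => z _; ring.
rewrite mul0r addr0 in cvg3.
have {}cvg3 : (fun=> 0 : R) @ \oo -->
    \int[mu_tx]_z (theta z * (dt phi z + dot_grad u phi z)) + c0'.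
  by move: cvg3; under eq_fun do rewrite E.
by rewrite -(cvg_lim (@Rhausdorff R) cvg3) lim_cst.
Qed.

End limit_equation.
End transport_limit.

(** * Integrals in time against sharp cutoffs *)

Section time_integrals.
Variable R : realType.
Local Notation mu_t := (@time_measure R).
Local Notation leb := (@lebesgue_measure R).

(** The bound is only almost everywhere, to cover the factor max 0 (b - t), which is bounded on
    [0, 1] but not on the line. *)
Lemma Rintegral_ae_bounded_factor d1 d2 (T1 : measurableType d1)
    (T2 : measurableType d2) (m1 : {finite_measure set T1 -> \bar R})
    (m2 : {finite_measure set T2 -> \bar R}) (f : T1 -> R) (g : T1 * T2 -> R) (M : R) :
  measurable_fun setT f -> (\forall x \ae m1, `|f x| <= M) ->
  rintegrable (m1 \x m2)%E g ->
  rintegrable (m1 \x m2)%E (fun z => f z.1 * g z) /\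
  \int[(m1 \x m2)%E]_z (f z.1 * g z) = \int[m1]_x (f x * \int[m2]_y g (x, y)).
Proof.
move=> mf fM ig.
have mg : measurable_fun setT g by apply/measurable_EFinP; exact: measurable_int ig.
have mfz : measurable_fun setT (fun z : T1 * T2 => f z.1).
  exact: (measurableT_comp mf measurable_fst).
have ifg : rintegrable (m1 \x m2)%E (fun z => f z.1 * g z).
  apply/integrableP; split; first by apply/measurable_EFinP; exact: measurable_funM.
  have : rintegrable (m1 \x m2)%E (fun z => M * `|g z|).
    exact: (integrableZl measurableT M (integrable_norm ig)).
  move=> /integrableP[_]; apply: le_lt_trans; apply: ae_ge0_le_integral => //.
  - by apply: (measurableT_comp (@abse_measurable _ _)); apply/measurable_EFinP;
      exact: measurable_funM.
  - apply: (measurableT_comp (@abse_measurable _ _)); apply/measurable_EFinP.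
    by apply: measurable_funM => //; exact: measurableT_comp.
  - have [N [mN N0 fN]] := @ae_fst _ _ _ _ _ m1 m2 _ fM.
    exists N; split => // z nz; apply: fN => /= fz; apply: nz => _.
    by rewrite lee_fin !normrM normr_id ler_wpM2r// (le_trans fz)// ler_norm.
split=> //; rewrite -(Rintegral_fubini1 ifg); apply: ae_eq_Rintegral.
- exact: (measurable_Rfubini1 ifg).
- by apply: measurable_funM => //; exact: (measurable_Rfubini1 ig).
- apply: ae_imply (ae_integrable1 ig) => x ix.
  by rewrite -RintegralZl.
Qed.

Lemma measurable_cutoff (b : R) : measurable_fun setT (fun t : R => (0 < b - t)%R%:R : R).
Proof.
have -> : (fun t : R => (0 < b - t)%R%:R : R) = \1_(`]-oo, b[%classic).
  by apply/funext => t; rewrite indicE mem_setE in_itv/= subr_gt0.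
exact: measurable_indic.
Qed.

Lemma Rintegral_cutoff (f : R -> R) (b : R) : measurable_fun setT f -> 0 <= b <= 1 ->
  \int[mu_t]_t ((0 < b - t)%R%:R * f t) = \int[leb]_(t in `[0, b]) f t.
Proof.
move=> mf /andP[b0 b1]; have mc := measurable_cutoff b.
rewrite Rintegral_lebesgue0; last exact: measurable_funM.
rewrite Rintegral_mkcond [RHS]Rintegral_mkcond; congr fine; apply: ae_eq_integral => //.
- apply/measurable_EFinP; apply/(measurable_restrictT _ _).1 => //.
  by apply/measurable_funTS; exact: measurable_funM.
- apply/measurable_EFinP; apply/(measurable_restrictT _ _).1 => //.
  exact/measurable_funTS.
(* The strict cutoff and the closed interval [0, b] disagree only at t = b. *)
- exists [set b]; split => //; first exact: lebesgue_measure_set1.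
  move=> t /= H; apply: contrapT => tb; apply: H => _; congr EFin.
  rewrite !patchE !mem_setE !in_itv/= subr_gt0.
  have [t0|//] := leP 0 t; case: ltgtP => [tb'|tb'|//].
    by rewrite (le_trans (ltW tb') b1) mul1r.
  by rewrite mul0r; case: ifP.
Qed.

(** The primitive of [f] vanishes on [0, 1[, and by Lebesgue differentiation its derivative is [f]
    almost everywhere. *)
Lemma cutoff_null_ae (f : R -> R) : rintegrable mu_t f ->
  (forall b, 0 <= b < 1 -> \int[mu_t]_t ((0 < b - t)%R%:R * f t) = 0) ->
  \forall t \ae mu_t, f t = 0.
Proof.
move=> intf f0; have mf := rintegrableP intf.
(* Extension by 0 gives a function integrable on the whole line, to which [FTC1] applies. *)
pose g : R -> R := f \_ (`[0, 1]%classic : set R).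
have ig : leb.-integrable setT (EFin \o g).
  rewrite /g -restrict_EFin.
  have h := (rintegrable_lebesgue0 1 mf).1 intf.
  have mI : measurable (`[0, 1]%classic : set (measurableTypeR R)).
    exact: measurable_itv.
  have h2 := (integrable_mkcond (EFin \o f : measurableTypeR R -> \bar R) mI).1 h.
  exact: h2.
have locg : locally_integrable setT g by apply: open_integrable_locally => //; exact: openT.
have igy y : leb.-integrable [set` Interval (BLeft 0) (BRight y)] (EFin \o g).
  by apply: integrableS ig.
have FTC := FTC1 igy locg.
have F0 y : 0 <= y < 1 -> \int[leb]_(t in `[0, y]) g t = 0.
  move=> /andP[y0 y1]; rewrite -[RHS](f0 y) ?y0// Rintegral_cutoff ?y0 ?ltW//.
  apply: eq_Rintegral => t; rewrite inE/= in_itv/= => /andP[t0 ty].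
  by rewrite /g patchE mem_setE in_itv/= t0 (le_trans ty (ltW y1)).
apply: lebesgue0_ae.
have gen : \forall t \ae leb, t != 0 /\ t != 1.
  exists ([set 0] `|` [set 1]); split.
  - exact: measurableU.
  - by apply: countable_lebesgue_measure0; apply: finite_set_countable; rewrite finite_setU.
  - move=> t /= nt; apply: contrapT => /not_orP[t0 t1]; apply: nt.
    by split; apply/eqP.
apply: (@filterS2 _ _ (ae_filter_ringOfSetsType leb) _ _ _ _ FTC gen) => t ft [t0 t1]; rewrite in_itv/= => /andP[t0' t1'].
have tI : 0 < t < 1 by rewrite !lt_neqAle eq_sym t0 t0' t1 t1'.
case/andP: tI => t_gt0 t_lt1.
have [|_] := ft; first by rewrite lte_fin.
have gt : g t = f t by rewrite /g patchE mem_set//= in_itv/= t0' t1'.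
rewrite derive1E gt => <-.
rewrite -[RHS](derive_cst 0 t (1 : R)); apply: near_eq_derive; near=> y.
by apply: F0; apply/andP; split; [apply: ltW|]; near: y; [exact: lt_nbhsr|exact: lt_nbhsl].
Unshelve. all: by end_near. Qed.

Lemma Rintegral_cutoff2 (b t : R) : 0 <= b <= 1 -> 0 <= t ->
  \int[mu_t]_r ((0 < b - r)%R%:R * (0 < r - t)%R%:R) = Num.max 0 (b - t).
Proof.
move=> /andP[b0 b1] t0.
have E r : (0 < b - r)%R%:R * (0 < r - t)%R%:R = \1_(`]t, b[%classic) r :> R.
  rewrite indicE mem_setE in_itv/= !subr_gt0.
  by case: (t < r) => /=; rewrite ?mulr1 ?mulr0.
under eq_Rintegral do rewrite E.
rewrite /Rintegral integral_indic// setIT.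
rewrite /time_measure /lebesgue0 /= /mfrestr /mrestr setIidl; last first.
  move=> r /=; rewrite !in_itv/= => /andP[tr rb].
  by rewrite (ltW (le_lt_trans t0 tr)) (ltW (lt_le_trans rb b1)).
rewrite lebesgue_measure_itv/= lte_fin; case: ltP => tb.
  by rewrite /= max_r// subr_ge0 ltW.
by rewrite /= max_l// subr_le0.
Qed.

Lemma Rintegral_cutoff_cst (b c : R) : 0 <= b <= 1 ->
  \int[mu_t]_r ((0 < b - r)%R%:R * c) = b * c.
Proof.
move=> bI; rewrite Rintegral_cutoff//; case/andP: bI => b0 b1.
rewrite Rintegral_cst//= lebesgue_measure_itv/= lte_fin.
case: ltP => b0' /=; first by rewrite subr0 mulrC.
have -> : b = 0 by apply: le_anti; rewrite b0 b0'.
by rewrite mulr0 mul0r.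
Qed.

(* The double integral of [f] over t < r < b, with the [r] integral computed first. *)
Lemma Rintegral_cutoff_primitive (f : R -> R) (b : R) : rintegrable mu_t f ->
  0 <= b <= 1 ->
  rintegrable mu_t (fun r => \int[mu_t]_t ((0 < r - t)%R%:R * f t)) /\
  \int[mu_t]_r ((0 < b - r)%R%:R * \int[mu_t]_t ((0 < r - t)%R%:R * f t)) =
  \int[mu_t]_t (Num.max 0 (b - t) * f t).
Proof.
move=> intf bI; have mf := rintegrableP intf.
pose K (z : R * R) : R := (0 < z.1 - z.2)%R%:R.
have mK : measurable_fun [set: plane R] (K : plane R -> R).
  have -> : (K : plane R -> R) = (\1_(`]0, +oo[%classic) : R -> R) \o (fun z : plane R => z.1 - z.2).
    by apply/funext => z; rewrite /= indicE mem_setE in_itv/= andbT.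
  apply: measurableT_comp; first exact: measurable_indic.
  by apply: measurable_funB; [exact: measurable_fst|exact: measurable_snd].
have intf2 : rintegrable (mu_t \x mu_t)%E (fun z => f z.2).
  have mf2 : measurable_fun [set: plane R] (fun z : plane R => (f z.2)%:E).
    by apply/measurable_EFinP; exact: (measurableT_comp mf measurable_snd).
  apply: (integrable12ltyP mu_t mu_t mf2).2 => /=.
  have /integrableP[_ fy] := intf.
  rewrite integral_cst// lte_mul_pinfty//; first exact: integral_ge0.
  - by rewrite ge0_fin_numE// integral_ge0.
  - by apply: (@le_lt_trans _ _ 1%:E); [rewrite -(time_measureT R)|exact: ltry].
have intK : rintegrable (mu_t \x mu_t)%E (fun z => K z * f z.2).
  apply: le_integrable intf2 => //.
    apply/measurable_EFinP; apply: measurable_funM => //.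
    exact: (measurableT_comp mf measurable_snd).
  move=> z _; rewrite lee_fin normrM ler_piMl// /K.
  by case: (0 < _); rewrite ?normr1 ?normr0.
split; first exact: (rintegrable_Rfubini1 intK).
have [ibK <-] : rintegrable (mu_t \x mu_t)%E
      (fun z => (0 < b - z.1)%R%:R * (K z * f z.2)) /\
    \int[(mu_t \x mu_t)%E]_z ((0 < b - z.1)%R%:R * (K z * f z.2)) =
    \int[mu_t]_r ((0 < b - r)%R%:R * \int[mu_t]_t ((0 < r - t)%R%:R * f t)).
  apply: (@Rintegral_ae_bounded_factor _ _ _ _ mu_t mu_t
    (fun r => (0 < b - r)%R%:R) (fun z => K z * f z.2) 1).
  - exact: measurable_cutoff.
  - by apply: aeW => r; case: (0 < _); rewrite ?normr1 ?normr0.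
  - exact: intK.
rewrite -(Rintegral_fubini2 ibK); apply: ae_eq_Rintegral.
- exact: (measurable_Rfubini2 ibK).
- apply: measurable_funM => //; apply: measurable_maxr => //.
  exact: measurable_funB.
- apply: ae_imply (ae_time_itv R) => t /andP[t0 t1] /=.
  rewrite -(Rintegral_cutoff2 bI t0) -RintegralZr//; last first.
    apply: (@rintegrable_bounded _ _ _ _ _ 1).
      apply: measurable_funM; first exact: measurable_cutoff.
      exact: (measurableT_comp mK (pair2_measurable t)).
    by move=> r; case: (0 < _); case: (0 < _); rewrite ?mulr0 ?mulr1 ?normr1 ?normr0.
  by apply: eq_Rintegral => r _; rewrite /K mulrA.
Qed.

End time_integrals.

(** * Time continuity of the Fourier coefficients of the limit *)

Section transport_of_modes.
Variable R : realType.
Local Notation mu_t := (@time_measure R).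
Local Notation mu_x := (@torus_measure R).
Local Notation mu_tx := (@spacetime_measure R).
Implicit Types (h : R * (R * R) -> R) (k : int * int).

(** This is u . grad T for T = [trig_mode k al be]. *)
Definition mode_flux (u : R * (R * R) -> R * R) k (al be : R) (z : R * (R * R)) : R :=
  ((u z).1 * (wavevector R k).1 + (u z).2 * (wavevector R k).2) *
    trig_mode k be (- al) z.2.

Lemma dot_grad_modulated u (c b : R) k al be z : 0 < c ->
  dot_grad u (modulated c b k 1 al be) z = flat c 1 (b - z.1) * mode_flux u k al be z.
Proof.
by move=> c0; rewrite /dot_grad dx1_modulated// dx2_modulated// /modulated
  /mode_flux /trig_mode; ring.
Qed.

Lemma measurable_mode_flux u k al be : Linf_field u ->
  measurable_fun [set: spacetime R] (mode_flux u k al be : spacetime R -> R).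
Proof.
move=> /Linf_fieldP[m1 m2 _]; apply: measurable_funM.
  by apply: measurable_funD; apply: measurable_funM.
exact: (measurable_space_comp (measurable_trig_mode k be (- al))).
Qed.

Lemma mode_flux_bounded u k al be : Linf_field u ->
  exists M, \forall z \ae mu_tx, `|mode_flux u k al be z| <= M.
Proof.
move=> /Linf_fieldP[_ _ [M uM]].
exists ((M * `|(wavevector R k).1| + M * `|(wavevector R k).2|) * (`|be| + `|- al|)).
move: uM; apply: ae_imply => z [u1 u2]; rewrite normrM; apply: ler_pM => //.
  by rewrite (le_trans (ler_normD _ _))// !normrM lerD// ler_wpM2r.
exact: trig_mode_bounded.
Qed.

Section fixed_mode.
Variables (u : R * (R * R) -> R * R) (theta0 : R * R -> R).
Hypothesis u_Linf : Linf_field u.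
Hypothesis theta0_sqint : sqint mu_x theta0.
Variables (thetaj : nat -> R * (R * R) -> R) (theta : R * (R * R) -> R).
Variables (kappa_ : nat -> R).
Hypothesis thetaj_sol : forall j, solves u (kappa_ j) theta0 (thetaj j).
Hypothesis kappa_cvg : kappa_ j @[j --> \oo] --> (0 : R).
Hypothesis thetaj_cvg : weak_star_cvg thetaj theta.
Hypothesis theta_sqint : sqint mu_tx theta.
Variables (k : int * int) (al be : R).

Local Notation T := (trig_mode k al be).
Local Notation W := (mode_flux u k al be).

(** The limit c -> 0 in [limit_equation]. For the mode coefficient A and its rate G it is the
    equation A' = G with initial datum, integrated twice in time from 0 to [b]. *)
Lemma sharp_cutoff_equation (b : R) : 0 <= b < 1 ->
  \int[mu_tx]_z (theta z * (- (0 < b - z.1)%R%:R * T z.2 + Num.max 0 (b - z.1) * W z))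
  + b * \int[mu_x]_x (theta0 x * T x) = 0.
Proof.
move=> /andP[b0 b1].
pose c n : R := n.+1%:R^-1.
have c0 n : 0 < c n by rewrite invr_gt0.
have [N WN] := mode_flux_bounded k al be u_Linf.
have [mth _] := theta_sqint.
pose phi n := modulated (c n) b k 1 al be.
have eqn n : \int[mu_tx]_z (theta z * (dt (phi n) z + dot_grad u (phi n) z)) +
    flat (c n) 1 b * \int[mu_x]_x (theta0 x * T x) = 0.
  rewrite -[RHS](limit_equation u_Linf k al be thetaj_sol kappa_cvg thetaj_cvg (c0 n) b1).
  congr (_ + _); rewrite -RintegralZl//; last first.
    by apply: sqint_mul => //; exact: sqint_trig_mode.
  by apply: eq_Rintegral => x _; rewrite /modulated subr0 /trig_mode mulrCA.
have dtE n z : dt (phi n) z = - flat (c n) (flat_deriv (c n) 1) (b - z.1) * T z.2.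
  by rewrite /phi dt_modulated// /modulated /trig_mode; ring.
have mmax : measurable_fun setT (fun z : spacetime R => Num.max 0 (b - z.1)).
  apply: measurable_maxr => //; apply: measurable_funB => //; exact: measurable_fst.
have mlt : measurable_fun setT (fun z : spacetime R => (0 < b - z.1)%R%:R : R).
  exact: (measurable_time_comp (measurable_cutoff b)).
have mT := measurable_space_comp (measurable_trig_mode k al be).
have mW := measurable_mode_flux k al be u_Linf.
have lim1 : (\int[mu_tx]_z (theta z * (dt (phi n) z + dot_grad u (phi n) z))) @[n --> \oo] -->
    \int[mu_tx]_z (theta z * (- (0 < b - z.1)%R%:R * T z.2 + Num.max 0 (b - z.1) * W z)).
  (* For every n the derivative of the cutoff is at most 1 in modulus, the cutoff at most |b| + 1 on
     [0, 1], and the flux at most N almost everywhere. *)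
  pose B := (`|al| + `|be|) + (`|b| + 1) * N.
  apply: (@Rintegral_dominated _ _ _ mu_tx
    (fun n z => theta z * (dt (phi n) z + dot_grad u (phi n) z)) _
    (fun z => B * `|theta z|)).
  - move=> n; apply: measurable_funM => //; apply: measurable_funD.
      by have [] := sqint_modulated b k (flat_deriv (c n) 1) (- al) (- be) (c0 n);
        rewrite /phi dt_modulated.
    by have [] := sqint_dot_grad u_Linf b k 1 al be (c0 n).
  - apply: measurable_funM => //; apply: measurable_funD; last exact: measurable_funM.
    by apply: measurable_funM => //; exact: measurableT_comp.
  - apply: aeW => z; apply: cvgM; first exact: cvg_cst.
    under eq_fun do rewrite dtE dot_grad_modulated//.
    apply: cvgD; apply: cvgM; try exact: cvg_cst.
      by apply: cvgN; exact: flat_deriv1_cvg.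
    exact: flat1_cvg.
  - apply: rintegrableZ; have [_ _] := theta_sqint.
    exact: integrable_norm (sqint_rintegrable theta_sqint).
  - move: (ae_and WN (ae_spacetime_itv R)); apply: ae_imply => z [Wz /andP[z0 z1]] n.
    rewrite normrM mulrC ler_wpM2r// (le_trans (ler_normD _ _))// lerD//.
      rewrite dtE normrM -[leRHS]mul1r ler_pM ?trig_mode_bounded//.
      have /andP[f0 f1] := flat_deriv1_itv (b - z.1) (ltW (c0 n)).
      by rewrite normrN ger0_norm.
    rewrite dot_grad_modulated// normrM ler_pM//.
    have /andP[f0 f1] := flat1_itv (b - z.1) (ltW (c0 n)).
    rewrite ger0_norm// (le_trans f1)// (le_trans (ler_normB _ _))// lerD2l.
    by rewrite ger0_norm.
have lim2 : (flat (c n) 1 b * \int[mu_x]_x (theta0 x * T x)) @[n --> \oo] -->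
    b * \int[mu_x]_x (theta0 x * T x).
  apply: cvgM; last exact: cvg_cst.
  by have := @flat1_cvg R b; rewrite (max_idPr b0).
have : (\int[mu_tx]_z (theta z * (dt (phi n) z + dot_grad u (phi n) z)) +
    flat (c n) 1 b * \int[mu_x]_x (theta0 x * T x)) @[n --> \oo] -->
    \int[mu_tx]_z (theta z * (- (0 < b - z.1)%R%:R * T z.2 + Num.max 0 (b - z.1) * W z))
    + b * \int[mu_x]_x (theta0 x * T x).
  exact: cvgD.
under eq_fun do rewrite eqn.
by move=> /(cvg_lim (@Rhausdorff R)) <-; rewrite lim_cst.
Qed.

Definition mode_coef (t : R) : R := \int[mu_x]_x (theta (t, x) * T x).
Definition mode_rate (t : R) : R := \int[mu_x]_x (theta (t, x) * W (t, x)).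

Lemma rintegrable_theta_T : rintegrable mu_tx (fun z => theta z * T z.2).
Proof.
apply: sqint_mul => //; apply: (@sqint_bounded _ _ _ _ _ (`|al| + `|be|)).
  exact: (measurable_space_comp (measurable_trig_mode k al be)).
by move=> z; exact: trig_mode_bounded.
Qed.

Lemma rintegrable_theta_W : rintegrable mu_tx (fun z => theta z * W z).
Proof.
have [N WN] := mode_flux_bounded k al be u_Linf.
apply: sqint_mul => //; apply: (@sqint_ae_bounded _ _ _ _ _ N) => //.
exact: measurable_mode_flux.
Qed.

Lemma rintegrable_mode_coef : rintegrable mu_t mode_coef.
Proof. exact: (@rintegrable_Rfubini1 _ _ _ _ _ mu_t mu_x _ rintegrable_theta_T). Qed.

Lemma rintegrable_mode_rate : rintegrable mu_t mode_rate.
Proof. exact: (@rintegrable_Rfubini1 _ _ _ _ _ mu_t mu_x _ rintegrable_theta_W). Qed.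

(** Exchanging integrals turns the weight (b - t)^+ into a double integral of the rate. The sharp
    equation then says that the coefficient minus c0 minus the primitive [Gam] of the rate has zero
    integral over [0, b] for every b in [0, 1[, hence vanishes a.e. *)
Lemma mode_coef_continuous : exists C : R -> R, {within `[0, 1], continuous C} /\
  \forall t \ae mu_t, mode_coef t = C t.
Proof.
pose c0 := \int[mu_x]_x (theta0 x * T x).
have iA := rintegrable_mode_coef; have iG := rintegrable_mode_rate.
have mG : measurable_fun setT mode_rate by exact: rintegrableP iG.
pose Gam (r : R) := \int[mu_t]_t ((0 < r - t)%R%:R * mode_rate t).
have iGam : rintegrable mu_t Gam.
  have h01 : 0 <= (0 : R) <= 1 by rewrite lexx ler01.
  by have [] := Rintegral_cutoff_primitive iG h01.
exists (fun r => c0 + \int[lebesgue_measure]_(t in `[0, r]) mode_rate t); split.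
  have := parameterized_integral_continuous (@ler01 R) ((rintegrable_lebesgue0 1 mG).1 iG).
  by move=> cG x; apply: cvgD; [exact: cvg_cst|exact: cG].
have cutoff_int (b : R) f : rintegrable mu_t f ->
    rintegrable mu_t (fun t => (0 < b - t)%R%:R * f t).
  move=> intf; apply: rintegrable_le (integrable_norm intf) _.
    by apply: measurable_funM; [exact: measurable_cutoff|exact: rintegrableP intf].
  by move=> t; rewrite normrM ler_piMl//; case: (0 < _); rewrite ?normr1 ?normr0.
have : \forall t \ae mu_t, mode_coef t - (c0 + Gam t) = 0.
  apply: cutoff_null_ae.
    by apply: rintegrableB => //; apply: rintegrableD => //; exact: rintegrable_cst.
  move=> b /andP[b0 b1]; have bI : 0 <= b <= 1 by rewrite b0 ltW.
  have [_ GamE] := Rintegral_cutoff_primitive iG bI.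
  have bI' : 0 <= b < 1 by rewrite b0.
  have := sharp_cutoff_equation bI'.
  have [i1 E1] : rintegrable mu_tx (fun z => (0 < b - z.1)%R%:R * (theta z * T z.2)) /\
      \int[mu_tx]_z ((0 < b - z.1)%R%:R * (theta z * T z.2)) =
      \int[mu_t]_t ((0 < b - t)%R%:R * mode_coef t).
    apply: (@Rintegral_ae_bounded_factor _ _ _ _ _ mu_t mu_x
      (fun r => (0 < b - r)%R%:R) (fun z => theta z * T z.2) 1).
    - exact: measurable_cutoff.
    - by apply: aeW => r; case: (0 < _); rewrite ?normr1 ?normr0.
    - exact: rintegrable_theta_T.
  have [i2 E2] : rintegrable mu_tx (fun z => Num.max 0 (b - z.1) * (theta z * W z)) /\
      \int[mu_tx]_z (Num.max 0 (b - z.1) * (theta z * W z)) =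
      \int[mu_t]_t (Num.max 0 (b - t) * mode_rate t).
    apply: (@Rintegral_ae_bounded_factor _ _ _ _ _ mu_t mu_x
      (fun r => Num.max 0 (b - r)) (fun z => theta z * W z) 1).
    - by apply: measurable_maxr => //; exact: measurable_funB.
    - move: (ae_time_itv R); apply: ae_imply => t /andP[t0 t1].
      by rewrite ger0_norm ?le_max ?lexx// ge_max ler01/=; lra.
    - exact: rintegrable_theta_W.
  have -> : \int[mu_tx]_z (theta z * (- (0 < b - z.1)%R%:R * T z.2 +
      Num.max 0 (b - z.1) * W z)) =
      \int[mu_t]_t (Num.max 0 (b - t) * mode_rate t) -
      \int[mu_t]_t ((0 < b - t)%R%:R * mode_coef t).
    by rewrite -E1 -E2 -RintegralB//; apply: eq_Rintegral => z _; ring.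
  rewrite -GamE -(Rintegral_cutoff_cst c0 bI) => eq0.
  under eq_Rintegral do rewrite mulrBr mulrDr.
  have ic : rintegrable mu_t (fun t => (0 < b - t)%R%:R * c0).
    exact: (cutoff_int _ _ (rintegrable_cst _ _)).
  have iGb := cutoff_int b _ iGam; have iAb := cutoff_int b _ iA.
  rewrite RintegralB//; last exact: rintegrableD.
  have lin (p q r : R) : p - q + r = 0 -> q - (r + p) = 0 by lra.
  by rewrite (RintegralD measurableT ic iGb); exact: lin eq0.
move=> H; move: (ae_and H (ae_time_itv R)); apply: ae_imply => t [/eqP + tI].
by rewrite subr_eq0 => /eqP ->; rewrite /Gam Rintegral_cutoff.
Qed.

End fixed_mode.
End transport_of_modes.

(** * Sobolev weights and the tail of the energy *)

Section weighted_energy.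
Variable R : realType.
Local Notation mu_x := (@torus_measure R).
Implicit Types (f g : R * R -> R) (k : int * int).

(** The [fourier_energy] of (- Delta)^(s/2) f, written with the coefficients of [f] so that it makes
    sense without that function. *)
Definition weighted_energy (s : R) F f : R :=
  (Num.sqrt 2)^-1 *
    \sum_(k <- F) (wavenumber R k `^ s) ^+ 2 * (coscoef f k ^+ 2 + sincoef f k ^+ 2).

Lemma frac_laplacian_coef (s : R) f g k : frac_laplacian s f g ->
  coscoef g k = wavenumber R k `^ s * coscoef f k /\
  sincoef g k = wavenumber R k `^ s * sincoef f k.
Proof.
move=> [_ /(_ k) /eqP]; rewrite eq_complex /= !mul0r subr0 addr0 !(mulrN, mulNr).
rewrite eqr_opp => /andP[/eqP h1 /eqP h2]; split.
  by apply: (mulfI (_ : (Num.sqrt 2)^-1 != 0)); [rewrite invr_neq0 ?sqrt2_neq0|rewrite mulrCA].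
by apply: (mulfI (_ : (Num.sqrt 2)^-1 != 0)); [rewrite invr_neq0 ?sqrt2_neq0|rewrite mulrCA].
Qed.

(** The strict bound on the infimum yields an actual fractional Laplacian of norm less than [K], to
    which Bessel's inequality applies. *)
Lemma weighted_energy_Hs (s : R) n f (K : R) :
  (Hs_norm s f < K%:E)%E -> weighted_energy s (box n) f <= K ^+ 2.
Proof.
move=> /ereal_inf_lt[_ [g fg <-] gK].
have sg : sqint mu_x g by apply: sqint_L2; case: fg.
have g0 : (0 <= L2norm g)%E by exact: Lnorm_ge0.
have K0 : 0 <= K by rewrite -lee_fin (le_trans g0)// ltW.
have -> : weighted_energy s (box n) f = fourier_energy (box n) g.
  congr (_ * _); apply: eq_bigr => k _.
  by have [-> ->] := frac_laplacian_coef k fg; ring.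
apply: (le_trans (bessel sg (sym_box n))).
rewrite -lee_fin -sqr_L2norm_sqint// -powR_mulrn// -poweR_EFin.
by apply: gt0_ler_poweR => //; rewrite ?in_itv/= ?g0 ?leey ?lee_fin ?K0// ltW.
Qed.

(** Some coordinate of [k] is at least n + 1 in modulus, and it is multiplied by 2 pi / sqrt 2 or 2
    pi, both larger than 1. *)
Lemma wavenumber_notin_box n k : k \notin box n -> n.+1%:R <= wavenumber R k.
Proof.
have sqz (m : int) : (n < absz m)%N -> n.+1%:R ^+ 2 <= (m%:~R : R) ^+ 2.
  move=> nm; rewrite -(real_normK (num_real m%:~R)) lerXn2r ?nnegrE ?ler0n//.
  by rewrite -intr_norm -[n.+1%:R]/(n.+1%:Z%:~R) ler_int; lia.
have pi2 : 2 <= pi :> R := pi_ge2 R.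
have s2sq : Num.sqrt 2 ^+ 2 = 2 :> R by rewrite sqr_sqrtr.
rewrite mem_box negb_and -!ltnNge => nk.
rewrite /wavenumber -[leLHS]ger0_norm// -sqrtr_sqr ler_wsqrtr//.
have -> : (wavevector R k).1 ^+ 2 = 2 * pi ^+ 2 * k.1%:~R ^+ 2.
  rewrite /wavevector /= !(exprMn, exprVn) s2sq.
  by field.
rewrite /wavevector /= !exprMn.
have := sqr_ge0 (k.1%:~R : R); have := sqr_ge0 (k.2%:~R : R).
have p4 : 4 <= pi ^+ 2 :> R by nra.
by case/orP: nk => /sqz; nra.
Qed.

(** Modes outside [box n] carry a squared weight of at least (n + 1)^(2 s). *)
Lemma fourier_energy_tail (s : R) n m f : 0 < s -> (n <= m)%N ->
  fourier_energy (box n) f <= fourier_energy (box m) f /\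
  fourier_energy (box m) f - fourier_energy (box n) f <=
    (n.+1%:R `^ s ^+ 2)^-1 * weighted_energy s (box m) f.
Proof.
move=> s0 nm; have i2 : 0 <= (Num.sqrt 2)^-1 :> R by rewrite invr_ge0 sqrtr_ge0.
pose e k := coscoef f k ^+ 2 + sincoef f k ^+ 2.
have e0 k : 0 <= e k by rewrite addr_ge0 ?sqr_ge0.
have un := (sym_box n).1; have um := (sym_box m).1.
have split_box : \sum_(k <- box m) e k =
    \sum_(k <- box n) e k + \sum_(k <- box m | k \notin box n) e k.
  rewrite (bigID (mem (box n)))/=; congr (_ + _).
  rewrite -big_filter; apply: perm_big; apply: uniq_perm; rewrite ?filter_uniq//.
  move=> k; rewrite mem_filter andbC; have := sub_box nm (x := k).
  by case: (k \in box n) => [->|] //; rewrite andbF.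
rewrite /fourier_energy -/(e _) split_box; split.
  by rewrite ler_wpM2l// lerDl sumr_ge0.
rewrite mulrDr addrC addKr /weighted_energy mulrCA ler_wpM2l//.
have L0 : 0 < n.+1%:R `^ s ^+ 2 :> R by rewrite exprn_gt0// powR_gt0.
rewrite ler_pdivlMl// mulr_sumr.
rewrite [leRHS](bigID (mem (box n)))/=; apply: ler_wpDl.
  by apply: sumr_ge0 => k _; apply: mulr_ge0; [exact: sqr_ge0|exact: e0].
apply: ler_sum => k kn; rewrite ler_wpM2r//.
rewrite lerXn2r ?nnegrE ?powR_ge0//.
apply: ge0_ler_powR; [exact: ltW|by rewrite nnegrE|by rewrite nnegrE sqrtr_ge0|].
exact: wavenumber_notin_box.
Qed.

Lemma tail_factor_small (s K e : R) : 0 < s -> 0 < e ->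
  exists n, (n.+1%:R `^ s ^+ 2)^-1 * K < e.
Proof.
(* It suffices that (n + 1)^s >= y: since y >= 1, also (n + 1)^(2 s) >= y, and y e > |K|. *)
move=> s0 e0; pose y := `|K| / e + 1.
have y1 : 1 <= y by rewrite lerDr divr_ge0// ltW.
have y0 : 0 <= y by apply: le_trans y1.
have [n yn] : exists n : nat, y `^ s^-1 <= n.+1%:R.
  exists (Num.truncn (y `^ s^-1)); apply: ltW; exact: truncnS_gt.
exists n.
have yL : y <= n.+1%:R `^ s.
  have yE : y = (y `^ s^-1) `^ s by rewrite -powRrM mulVf ?gt_eqF// powRr1.
  rewrite [leLHS]yE.
  by apply: ge0_ler_powR; [exact: ltW|by rewrite nnegrE powR_ge0|by rewrite nnegrE|].
have L0 : 0 < n.+1%:R `^ s ^+ 2 :> R by rewrite exprn_gt0// powR_gt0.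
rewrite ltr_pdivrMl//; apply: (le_lt_trans (ler_norm K)).
have Ky : `|K| < y * e by rewrite /y mulrDl mulfVK ?gt_eqF// mul1r ltrDl.
apply: (lt_le_trans Ky); apply: ler_wpM2r; first exact: ltW.
by apply: (le_trans yL); rewrite expr2 ler_peMl ?powR_ge0// (le_trans y1).
Qed.

End weighted_energy.

(** * Almost everywhere comparison of integrals *)

Section ae_order.
Context d (T : measurableType d) (R : realType).
Variable mu : {finite_measure set T -> \bar R}.
Implicit Types f g : T -> R.

Lemma ae_le_Rintegral f g : rintegrable mu f -> rintegrable mu g ->
  (\forall x \ae mu, f x <= g x) -> \int[mu]_x f x <= \int[mu]_x g x.
Proof.
move=> intf intg fg; have mf := rintegrableP intf; have mg := rintegrableP intg.
have mm : measurable_fun setT (fun x => Num.min (f x) (g x)) by exact: measurable_minr.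
(* Passing to the minimum makes the inequality hold at every point. *)
have -> : \int[mu]_x f x = \int[mu]_x (Num.min (f x) (g x)).
  by apply: ae_eq_Rintegral => //; apply: ae_imply fg => x fx; rewrite min_l.
apply: le_Rintegral => //; last by move=> x _; rewrite ge_min lexx orbT.
apply: (@rintegrable_le _ _ _ _ _ (fun x => `|f x| + `|g x|)) => //.
  by apply: rintegrableD; exact: integrable_norm.
by move=> x; rewrite /Order.min; case: ifP => _; rewrite ?lerDl ?lerDr normr_ge0.
Qed.

Lemma ae_eq0_Rintegral f : rintegrable mu f -> (\forall x \ae mu, 0 <= f x) ->
  \int[mu]_x f x <= 0 -> \forall x \ae mu, f x = 0.
Proof.
move=> intf f0 fle0; have mf := rintegrableP intf.
have mfE : measurable_fun setT (EFin \o f) by exact/measurable_EFinP.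
suff : ae_eq mu setT (EFin \o f) (cst 0%E).
  by apply: ae_imply => x /(_ I) [].
apply: (ae_eq_integral_abs mu measurableT mfE).1.
have -> : (\int[mu]_x `|(EFin \o f) x| = \int[mu]_x (f x)%:E)%E.
  apply: ae_eq_integral => //; first exact: measurableT_comp.
  by apply: ae_imply f0 => x fx _ /=; rewrite ger0_norm.
apply/eqP; rewrite eq_le; apply/andP; split.
  by rewrite -(fineK (integrable_fin_num measurableT intf)) lee_fin.
have -> : (\int[mu]_x (f x)%:E = \int[mu]_x `|(EFin \o f) x|)%E.
  apply: ae_eq_integral => //; first exact: measurableT_comp.
  by apply: ae_imply f0 => x fx _ /=; rewrite ger0_norm.
exact: integral_ge0.
Qed.

Lemma ae_all_seq (I : eqType) (r : seq I) (P : I -> T -> Prop) :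
  (forall i, \forall x \ae mu, P i x) ->
  \forall x \ae mu, forall i, i \in r -> P i x.
Proof.
move=> aP; elim: r => [|i r IH]; first by apply: aeW.
move: (ae_and (aP i) IH); apply: ae_imply => x [Pi Pr] j.
by rewrite inE => /orP[/eqP ->|/Pr].
Qed.

End ae_order.

(** * Weak-* lower semicontinuity of the weighted energy *)

Section weak_star_lower_semicontinuity.
Variable R : realType.
Local Notation mu_t := (@time_measure R).
Local Notation mu_x := (@torus_measure R).
Local Notation mu_tx := (@spacetime_measure R).
Implicit Types (h : R * (R * R) -> R) (k : int * int).

Lemma rintegrable_slice_mode h (f : R * R -> R) : sqint mu_tx h -> sqint mu_x f ->
  (forall x, `|f x| <= 1) -> rintegrable mu_tx (fun z => h z * f z.2).
Proof.
move=> sh [mf _] f1; apply: sqint_mul => //.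
apply: (@sqint_bounded _ _ _ _ _ 1); first exact: measurable_space_comp.
by move=> z; exact: f1.
Qed.

Lemma measurable_coscoef_slice h k : sqint mu_tx h ->
  measurable_fun setT (fun t => coscoef (slice h t) k).
Proof.
move=> sh; have ih := rintegrable_slice_mode sh (sqint_cosk R k) (fun x => cos_max _).
exact: (@measurable_Rfubini1 _ _ _ _ _ mu_t mu_x _ ih).
Qed.

Lemma measurable_sincoef_slice h k : sqint mu_tx h ->
  measurable_fun setT (fun t => sincoef (slice h t) k).
Proof.
move=> sh; have ih := rintegrable_slice_mode sh (sqint_sink R k) (fun x => sin_max _).
exact: (@measurable_Rfubini1 _ _ _ _ _ mu_t mu_x _ ih).
Qed.

Variables (hn : nat -> R * (R * R) -> R) (h : R * (R * R) -> R) (s K : R) (n : nat).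
Hypothesis sqint_hn : forall j, sqint mu_tx (hn j).
Hypothesis sqint_h : sqint mu_tx h.
Hypothesis hn_cvg : weak_star_cvg hn h.
Hypothesis coscoef_bounded : forall k,
  exists M, \forall t \ae mu_t, `|coscoef (slice h t) k| <= M.
Hypothesis sincoef_bounded : forall k,
  exists M, \forall t \ae mu_t, `|sincoef (slice h t) k| <= M.
Hypothesis hn_bounded : forall N, exists2 j, (N <= j)%N &
  \forall t \ae mu_t, weighted_energy s (box n) (slice (hn j) t) <= K.

Let Q t := weighted_energy s (box n) (slice h t).
(** The times at which the bound fails for the limit; they turn out to be negligible. *)
Let D : set R := Q @^-1` `]K, +oo[.
Let w k : R := (Num.sqrt 2)^-1 * (wavenumber R k `^ s) ^+ 2.
Let a k t : R := w k * coscoef (slice h t) k.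
Let b k t : R := w k * sincoef (slice h t) k.
Let chi (t : R) : R := \1_D t.
(** At bad times, pairing a function with [g] in space gives its weighted inner product with [h]
    over the box; pairing [h] itself gives [Q]. *)
Let g (z : R * (R * R)) : R :=
  chi z.1 * \sum_(k <- box n) (a k z.1 * cosk k z.2 + b k z.1 * sink k z.2).

Let ma k : measurable_fun setT (a k).
Proof. by apply: measurable_funM => //; exact: measurable_coscoef_slice. Qed.

Let mb k : measurable_fun setT (b k).
Proof. by apply: measurable_funM => //; exact: measurable_sincoef_slice. Qed.

Let w_ge0 k : 0 <= w k.
Proof. by rewrite mulr_ge0 ?sqr_ge0// invr_ge0 sqrtr_ge0. Qed.

Let weighted_energyE f : weighted_energy s (box n) f =
  \sum_(k <- box n) w k * (coscoef f k ^+ 2 + sincoef f k ^+ 2).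
Proof. by rewrite /weighted_energy mulr_sumr; apply: eq_bigr => k _; rewrite mulrA. Qed.

Let mQ : measurable_fun setT Q.
Proof.
rewrite /Q; under eq_fun do rewrite weighted_energyE.
apply: measurable_sum => k; apply: measurable_funM => //; apply: measurable_funD.
  by apply: measurable_funX; exact: measurable_coscoef_slice.
by apply: measurable_funX; exact: measurable_sincoef_slice.
Qed.

Let mD : measurable D.
Proof. by rewrite /D -[_ @^-1` _]setTI; apply: mQ => //; exact: measurable_itv. Qed.

Let mchi : measurable_fun setT chi.
Proof. exact: measurable_indic. Qed.

Let chi_itv t : 0 <= chi t <= 1.
Proof. by rewrite /chi indicE; case: (_ \in _); rewrite ?lexx ler01. Qed.

(** The a.e. bounds on the coefficients of [h] enter here, making [g] an admissible test
    function. *)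
Let sqint_g : sqint mu_tx g.
Proof.
apply: (@sqintM_bounded _ _ _ _ _ _ 1).
- exact: (measurable_time_comp mchi).
- by move=> z; have /andP[c0 c1] := chi_itv z.1; rewrite ger0_norm.
apply: sqint_sum => k _; apply: sqintD; apply: sqint_ae_mul.
- exact: (measurable_time_comp (ma k)).
- exact: (measurable_space_comp (measurable_cosk k)).
- have [M aM] := coscoef_bounded k; exists (w k * M).
  apply: (@ae_fst _ _ _ _ _ mu_t mu_x (fun t => `|a k t| <= w k * M)).
  by move: aM; apply: ae_imply => t at_; rewrite normrM ger0_norm// ler_wpM2l.
- by exists 1; apply: aeW => z; exact: cos_max.
- exact: (measurable_time_comp (mb k)).
- exact: (measurable_space_comp (measurable_sink k)).
- have [M bM] := sincoef_bounded k; exists (w k * M).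
  apply: (@ae_fst _ _ _ _ _ mu_t mu_x (fun t => `|b k t| <= w k * M)).
  by move: bM; apply: ae_imply => t bt; rewrite normrM ger0_norm// ler_wpM2l.
- by exists 1; apply: aeW => z; exact: sin_max.
Qed.

Let U (f : R * (R * R) -> R) t := \int[mu_x]_x (f (t, x) * g (t, x)).

Let rintegrable_U f : sqint mu_tx f -> rintegrable mu_t (U f).
Proof.
move=> sf; exact: (@rintegrable_Rfubini1 _ _ _ _ _ mu_t mu_x _ (sqint_mul sf sqint_g)).
Qed.

Let Rintegral_U f : sqint mu_tx f -> \int[mu_t]_t U f t = \int[mu_tx]_z (f z * g z).
Proof.
move=> sf; exact: (@Rintegral_fubini1 _ _ _ _ _ mu_t mu_x _ (sqint_mul sf sqint_g)).
Qed.

Let U_coef f : sqint mu_tx f -> \forall t \ae mu_t, U f t =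
  chi t * \sum_(k <- box n) (a k t * coscoef (slice f t) k + b k t * sincoef (slice f t) k).
Proof.
move=> sf; move: (sqint_slice sf); apply: ae_imply => t st.
rewrite -(Rintegral_trig_sum _ _ _ st) -RintegralZl//; last first.
  by apply: sqint_mul => //; exact: sqint_trig_sum.
by apply: eq_Rintegral => x _; rewrite /g /slice /=; ring.
Qed.

(** At bad times, the inequality 2 x y <= x^2 + y^2 bounds the pairing of [hn j] with [g] by (Q + K)
    / 2. In the limit the integral of Q over the bad times is at most the mean of itself and of K
    times their measure. As Q > K there, they form a null set. *)
Lemma weak_star_weighted_energy :
  \forall t \ae mu_t, weighted_energy s (box n) (slice h t) <= K.
Proof.
have Uh : \forall t \ae mu_t, U h t = chi t * Q t.
  move: (U_coef sqint_h); apply: ae_imply => t ->; congr (_ * _).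
  by rewrite /Q weighted_energyE; apply: eq_bigr => k _; rewrite /a /b; ring.
have ichi : rintegrable mu_t chi.
  apply: (@rintegrable_bounded _ _ _ _ _ 1) => // t.
  by have /andP[c0 c1] := chi_itv t; rewrite ger0_norm.
have iUh := rintegrable_U sqint_h.
have iC : rintegrable mu_t (fun t => 2^-1 * (U h t + K * chi t)).
  by apply: rintegrableZ; apply: rintegrableD => //; exact: rintegrableZ.
have Uj j : (\forall t \ae mu_t, weighted_energy s (box n) (slice (hn j) t) <= K) ->
    \int[mu_tx]_z (hn j z * g z) <= \int[mu_t]_t (2^-1 * (U h t + K * chi t)).
  move=> hnK; rewrite -Rintegral_U//; apply: ae_le_Rintegral => //.
    exact: rintegrable_U.
  move: (ae_and (ae_and hnK Uh) (U_coef (sqint_hn j))); apply: ae_imply.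
  move=> t [[hK ->] ->]; have /andP[c0 _] := chi_itv t.
  rewrite (_ : 2^-1 * _ = chi t * (2^-1 * (Q t + K))); last by ring.
  apply: ler_wpM2l => //; apply: (@le_trans _ _ (2^-1 * (Q t +
    weighted_energy s (box n) (slice (hn j) t)))).
    rewrite /Q !weighted_energyE -big_split/= mulr_sumr; apply: ler_sum => k _.
    have -> : a k t * coscoef (slice (hn j) t) k + b k t * sincoef (slice (hn j) t) k =
      w k * (coscoef (slice h t) k * coscoef (slice (hn j) t) k +
             sincoef (slice h t) k * sincoef (slice (hn j) t) k).
      by rewrite /a /b; ring.
    rewrite -mulrDr mulrCA; apply: ler_wpM2l => //.
    have := sqr_ge0 (coscoef (slice h t) k - coscoef (slice (hn j) t) k).
    have := sqr_ge0 (sincoef (slice h t) k - sincoef (slice (hn j) t) k).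
    by nra.
  by rewrite ler_wpM2l// lerD2l.
have lim := hn_cvg (L1L2_sqint sqint_g).
have hle : \int[mu_tx]_z (h z * g z) <= \int[mu_t]_t (2^-1 * (U h t + K * chi t)).
  (* The whole sequence converges, so bounds at arbitrarily large j already bound the limit. *)
  rewrite leNgt; apply/negP => /(cvgr_gt _ lim) [N _ HN].
  have [j Nj /Uj] := hn_bounded N.
  by rewrite leNgt => /negP; apply; exact: HN.
have i0 : rintegrable mu_t (fun t => U h t - K * chi t).
  by apply: rintegrableB => //; exact: rintegrableZ.
have ae0 : \forall t \ae mu_t, U h t - K * chi t = 0.
  apply: ae_eq0_Rintegral => //.
    move: Uh; apply: ae_imply => t ->; rewrite /chi indicE.
    case: (boolP (t \in D)); last by rewrite !mul0r mulr0 subr0.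
    by rewrite inE /D /= in_itv/= andbT => /ltW; rewrite mul1r mulr1 subr_ge0.
  rewrite -Rintegral_U// in hle.
  have iKc := rintegrableZ K ichi.
  have UK : \int[mu_t]_t (2^-1 * (U h t + K * chi t)) =
      2^-1 * (\int[mu_t]_t U h t + \int[mu_t]_t (K * chi t)).
    have iKc' := rintegrableD iUh iKc.
    by rewrite [LHS](RintegralZl _ measurableT iKc') RintegralD.
  by rewrite UK in hle; rewrite RintegralB//; lra.
move: (ae_and ae0 Uh); apply: ae_imply => t [+ Ut]; rewrite Ut /chi indicE.
case: (boolP (t \in D)) => [|tD _].
  rewrite inE /D /= in_itv/= andbT mul1r mulr1 => tD /eqP.
  by rewrite subr_eq0 gt_eqF.
by move: tD; rewrite notin_setE /D /= in_itv/= andbT leNgt => /negP.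
Qed.

End weak_star_lower_semicontinuity.

(** * From almost every time to every time, and uniform limits *)

Lemma ae_le_everywhere (R : realType) (f : R -> R) (K : R) :
  {within `[0, 1], continuous f} -> (\forall t \ae (@time_measure R), f t <= K) ->
  forall t, 0 <= t <= 1 -> f t <= K.
Proof.
move=> cf /ae_lebesgue0 [N [mN N0 fN]] t /andP[t0 t1]; rewrite leNgt; apply/negP => Kt.
have tI : `[0, 1]%classic t by rewrite /= in_itv/= t0 t1.
have /(_ t tI) ct := (subspace_continuousP _ _).1 cf.
have [e /= e0 te] : \forall r \near within `[0, 1]%classic (nbhs t), K < f r.
  exact: (cvgr_gt _ ct _ Kt).
(* A value above K persists near t within [0, 1], hence on an interval of positive length, even when
   t is an endpoint. *)
pose p : R := Num.max 0 (t - e); pose q : R := Num.min 1 (t + e).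
have pq : p < q by rewrite /p /q lt_min !gt_max; lra.
have sub : `]p, q[%classic `<=` N.
  move=> r /=; rewrite in_itv/= /p /q gt_max lt_min => /andP[/andP[r0 rt] /andP[r1 rt']].
  apply: fN => /= H.
  have rI : r \in `[0, 1] by rewrite in_itv/= !ltW.
  have := H rI; apply/negP; rewrite -ltNge; apply: te => //.
  by rewrite /= ltr_norml; lra.
have : (lebesgue_measure `]p, q[%classic <= 0 :> \bar R)%E.
  by rewrite -N0; apply: le_measure => //; rewrite inE//; exact: measurable_itv.
by rewrite lebesgue_measure_itv/= lte_fin pq lee_fin; lra.
Qed.

Section continuous_energy.
Variable R : realType.
Local Notation mu_t := (@time_measure R).

(** The sequence is nondecreasing with gaps bounded by [del], so its pointwise limit is uniform. *)
Lemma continuous_uniform_limit (en : nat -> R -> R) (del : nat -> R) :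
  (forall n, {within `[0, 1], continuous (en n)}) ->
  (forall n m t, (n <= m)%N -> 0 <= t <= 1 -> en n t <= en m t <= en n t + del n) ->
  (forall e, 0 < e -> exists n, del n < e) ->
  exists2 c : R -> R, {within `[0, 1], continuous c} &
    forall n t, 0 <= t <= 1 -> en n t <= c t <= en n t + del n.
Proof.
move=> cen enm del0; pose c t := limn (fun n => en n t).
have cI n t : 0 <= t <= 1 -> en n t <= c t <= en n t + del n.
  move=> tI.
  have nd : nondecreasing_seq (fun n => en n t).
    by move=> i j ij; have /andP[] := enm _ _ _ ij tI.
  have cv : cvgn (fun n => en n t).
    apply: nondecreasing_is_cvgn => //; exists (en 0%N t + del 0%N) => _ [m _ <-].
    by have /andP[] := enm 0%N m t (leq0n m) tI.
  apply/andP; split; first exact: (nondecreasing_cvgn_le nd cv).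
  apply: limr_le => //; near=> m.
  have nm : (n <= m)%N by near: m; exact: nbhs_infty_ge.
  by have /andP[] := enm n m t nm tI.
exists c => //; apply/subspace_continuousP => t0 t0I.
have t0I' : 0 <= t0 <= 1 by move: t0I; rewrite /= in_itv.
apply/cvgrPdist_lt => e e0.
have e3 : 0 < e / 3 by lra.
have [n dn] := del0 _ e3.
have /(_ t0 t0I) /cvgrPdist_lt /(_ _ e3) cn := (subspace_continuousP _ _).1 (cen n).
have inI : \forall t \near within `[0, 1]%classic (nbhs t0), `[0, 1]%classic t.
  exact: withinT.
near=> t.
have tI : 0 <= t <= 1.
  have : `[0, 1]%classic t by near: t.
  by rewrite /= in_itv.
have : `|en n t0 - en n t| < e / 3 by near: t.
suff : `|en n t0 - en n t| < e / 3 -> `|c t0 - c t| < e by apply.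
have /andP[h1 h2] := cI n t tI; have /andP[h3 h4] := cI n t0 t0I'.
rewrite !ltr_norml => /andP[h5 h6]; apply/andP; split; lra.
Unshelve. all: by end_near. Qed.

Lemma within_continuous_bounded (f : R -> R) : {within `[0, 1], continuous f} ->
  exists M, forall t, 0 <= t <= 1 -> `|f t| <= M.
Proof.
move=> cf; have [p _ fp] := EVT_max (@ler01 R) cf; have [q _ fq] := EVT_min (@ler01 R) cf.
exists (`|f p| + `|f q|) => t tI; have tI' : t \in `[0, 1] by rewrite in_itv.
rewrite ler_norml; have := fp t tI'; have := fq t tI'.
have := ler_norm (f p); have := ler_norm (- f q); rewrite normrN.
by have := normr_ge0 (f p); have := normr_ge0 (f q); lra.
Qed.

End continuous_energy.

(** * Continuity of the energy when the H^s norms do not tend to infinity *)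

Theorem proposition1p10 (R : realType)
  (u : R * (R * R) -> R * R) (u_Linf : Linf_field u)
  (u_div : divergence_free u)
  (theta0 : R * R -> R) (theta0_L2 : L2 theta0)
  (thetak : R -> R * (R * R) -> R)
  (thetak_sol : forall kappa : R, 0 < kappa ->
     solves u kappa theta0 (thetak kappa))
  (theta : R * (R * R) -> R) (theta_LinfL2 : LinfL2 theta)
  (kappa_ : nat -> R) (kappa_gt0 : forall j, 0 < kappa_ j)
  (kappa_cvg : kappa_ j @[j --> \oo] --> (0 : R))
  (theta_cvg : weak_star_cvg (fun j => thetak (kappa_ j)) theta)
  (energy_disc : ~ ae_eq_continuous (energy theta))
  (s : R) (s_gt0 : 0 < s) :
  LinfHs_norm s (thetak (kappa_ j)) @[j --> \oo] --> +oo%E.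
Proof.
(* If the limit fails, some level [A] exceeds the norm for arbitrarily large j. *)
apply/cvgeyPge => A; apply: contrapT => not_large; apply: energy_disc.
have sol j : solves u (kappa_ j) theta0 (thetak (kappa_ j)) by exact: thetak_sol.
have sth0 := sqint_L2 theta0_L2; have sth := sqint_LinfL2 theta_LinfL2.
(* The amplitudes (1, 0) and (0, 1) will give the cosine and sine coefficients. *)
have coef k al be := mode_coef_continuous u_Linf sth0 sol kappa_cvg theta_cvg sth k al be.
have /choice[C HC] : forall k : int * int, exists f : R -> R,
    {within `[0, 1], continuous f} /\
    \forall t \ae (@time_measure R), coscoef (slice theta t) k = f t.
  move=> k; have [f [cf ff]] := coef k 1 0; exists f; split => //.
  move: ff; apply: ae_imply => t <-; apply: eq_Rintegral => x _.
  by rewrite /trig_mode mul1r mul0r addr0.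
have /choice[S HS] : forall k : int * int, exists f : R -> R,
    {within `[0, 1], continuous f} /\
    \forall t \ae (@time_measure R), sincoef (slice theta t) k = f t.
  move=> k; have [f [cf ff]] := coef k 0 1; exists f; split => //.
  move: ff; apply: ae_imply => t <-; apply: eq_Rintegral => x _.
  by rewrite /trig_mode mul1r mul0r add0r.
have Cbnd k : exists M, \forall t \ae (@time_measure R), `|coscoef (slice theta t) k| <= M.
  have [cC aC] := HC k; have [M CM] := within_continuous_bounded cC; exists M.
  by move: (ae_and aC (ae_time_itv R)); apply: ae_imply => t [->]; exact: CM.
have Sbnd k : exists M, \forall t \ae (@time_measure R), `|sincoef (slice theta t) k| <= M.
  have [cS aS] := HS k; have [M SM] := within_continuous_bounded cS; exists M.
  by move: (ae_and aS (ae_time_itv R)); apply: ae_imply => t [->]; exact: SM.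
have often n N : exists2 j, (N <= j)%N & \forall t \ae (@time_measure R),
    weighted_energy s (box n) (slice (thetak (kappa_ j)) t) <= A ^+ 2.
  have [j Nj] : exists2 j, (N <= j)%N & (LinfHs_norm s (thetak (kappa_ j)) < A%:E)%E.
    apply: contrapT => none; apply: not_large; exists N => // j /= Nj.
    by rewrite leNgt; apply/negP => jA; apply: none; exists j.
  rewrite /LinfHs_norm unlock time_measure_gt0 => jA; exists j => //.
  have := ess_sup_ge (@time_measure R)
    (abse \o (fun t => Hs_norm s (slice (thetak (kappa_ j)) t))).
  apply: ae_imply => t /= tA; apply: weighted_energy_Hs.
  by apply: le_lt_trans (le_lt_trans tA jA); exact: lee_abs.
have lsc n := weak_star_weighted_energy (fun j => sqint_LinfL2 (sol j).1) sth
  theta_cvg Cbnd Sbnd (often n).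
pose en n t := (Num.sqrt 2)^-1 * \sum_(k <- box n) (C k t ^+ 2 + S k t ^+ 2).
(* The bound of [fourier_energy_tail], with A^2 in place of the weighted energy. *)
pose del n := (n.+1%:R `^ s ^+ 2)^-1 * A ^+ 2.
have enE : \forall t \ae (@time_measure R), forall n,
    fourier_energy (box n) (slice theta t) = en n t.
  apply: ae_foralln => n.
  have := ae_all_seq (box n) (fun k => ae_and (HC k).2 (HS k).2).
  apply: ae_imply => t CS; congr (_ * _); apply: eq_big_seq => k /CS[-> ->] //.
have gap : \forall t \ae (@time_measure R), forall n m, (n <= m)%N ->
    en n t <= en m t <= en n t + del n.
  move: (ae_and enE (ae_foralln lsc)); apply: ae_imply => t [E L] n m nm.
  have [h1 h2] := fourier_energy_tail (slice theta t) s_gt0 nm.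
  rewrite -!E h1 /= -lerBlDl (le_trans h2)//; apply: ler_wpM2l; last exact: L.
  by rewrite invr_ge0 exprn_ge0// powR_ge0.
have cen n : {within `[0, 1], continuous (en n)}.
  have sum_cont (r : seq (int * int)) : {within `[0, 1],
      continuous (fun t => \sum_(k <- r) (C k t ^+ 2 + S k t ^+ 2))}.
    elim: r => [|k r IH].
      rewrite (_ : (fun t => _) = cst 0); last by apply/funext => t; rewrite big_nil.
      by move=> t; exact: cvg_cst.
    rewrite (_ : (fun t => _) = fun t => (C k t * C k t + S k t * S k t) +
      \sum_(k <- r) (C k t ^+ 2 + S k t ^+ 2)); last first.
      by apply/funext => t; rewrite big_cons.
    move=> t; apply: cvgD; last exact: IH.
    by apply: cvgD; apply: cvgM; first [exact: (HC k).1|exact: (HS k).1].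
  by move=> t; apply: cvgM; [exact: cvg_cst|exact: sum_cont].
(* The functions [en n] are continuous, so the a.e. inequalities extend to all of [0, 1], as uniform
   convergence requires. *)
have gap_everywhere n m t : (n <= m)%N -> 0 <= t <= 1 ->
    en n t <= en m t <= en n t + del n.
  move=> nm tI; apply/andP; split.
    rewrite -subr_le0; move: t tI; apply: ae_le_everywhere.
      by move=> t; apply: cvgB; exact: cen.
    by move: gap; apply: ae_imply => t /(_ _ _ nm) /andP[h _]; rewrite subr_le0.
  rewrite -lerBlDl; move: t tI; apply: ae_le_everywhere.
    by move=> t; apply: cvgB; exact: cen.
  by move: gap; apply: ae_imply => t /(_ _ _ nm) /andP[_ h]; rewrite lerBlDl.
have [c cc cI] := continuous_uniform_limit cen gap_everywhere
  (fun e => tail_factor_small (A ^+ 2) s_gt0).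
exists c; split => //.
move: (ae_and (ae_and enE gap) (ae_and (sqint_slice sth) (ae_time_itv R))).
apply: ae_imply => t [[E G] [st tI]].
rewrite /energy sqr_L2norm_sqint//; congr EFin; apply/eqP.
(* The energy and [c t] both lie between [en n t] and [en n t + del n], and [del n] can be made
   arbitrarily small. *)
have low n : en n t <= \int[torus_measure (R := R)]_x (slice theta t x ^+ 2).
  by rewrite -E; apply: bessel => //; exact: sym_box.
have up n : \int[torus_measure (R := R)]_x (slice theta t x ^+ 2) <= en n t + del n.
  (* Parseval may need a box larger than [box n]; the gap estimate brings the bound back to
     [en n]. *)
  apply/ler_addgt0Pr => e e0; have [N PN] := parseval st e0.
  apply: (le_trans (PN (maxn n N) (leq_maxr _ _))); rewrite E lerD2r.
  by have /andP[] := G n (maxn n N) (leq_maxl _ _).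
rewrite eq_le; apply/andP; split; apply/ler_addgt0Pr => e e0;
  have [n dn] := tail_factor_small (A ^+ 2) s_gt0 e0;
  have /andP[c1 c2] := cI n t tI; have := low n; have := up n; rewrite -/(del n) in dn; lra.
Qed.
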